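(* Let $\mathcal{A}$ be a simple $\sigma$-unital C*-algebra of real rank zero such that the set $\mathrm{Ext}(T(\mathcal{A}))$ of extremal points of $T(\mathcal{A})$ is infinite, the collection $D(\mathcal{A})$ of Murray-von Neumann equivalence classes of projections of $\mathcal{A}$ is countable, and $D(\mathcal{A}\otimes\mathcal{K})$ is dense in $\mathrm{Aff}\,T(\mathcal{A})_+$. Then $\mathcal{A}$ is not the linear span of its projections.
   Context: $\mathcal{K}$ is the algebra of compact operators on a separable Hilbert space and $\mathrm{Tr}$ its standard trace. If $\mathcal{A}$ is unital, $T(\mathcal{A})$ is the set of tracial states of $\mathcal{A}$ with the weak* topology. If $\mathcal{A}$ is simple, $\sigma$-unital, not unital, of real rank zero, let $\widetilde T(\mathcal{A})$ be the set of nonzero lower semicontinuous, semifinite (densely defined) tracial weights $\tau:\mathcal{A}_+\to[0,\infty]$, i.e. $\tau$ is additive, positively homogeneous, $\tau(xx^* )=\tau(x^*x)$ for all $x\in \mathcal{A}$, and $\{a\in\mathcal{A}:\tau(a^*a)<\infty\}$ is dense in $\mathcal{A}$. Such weights are faithful and finite on projections. For every nonzero projection $e\in\mathcal{A}$, every tracial state of $e\mathcal{A}e$ extends uniquely to an element of $\widetilde T(\mathcal{A})$, so that the tracial simplex $T(e\mathcal{A}e)$ is identified with $\{\tau/\tau(e):\tau\in\widetilde T(\mathcal{A})\}$. One fixes such an $e$ and writes $T(\mathcal{A})$ for the compact convex set $T(e\mathcal{A}e)$, viewing its elements as weights on $\mathcal{A}$ (the hypotheses do not depend on the choice of $e$).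 Each $\tau\in T(\mathcal{A})$ extends to the tracial weight $\tau\otimes\mathrm{Tr}$ on $\mathcal{A}\otimes\mathcal{K}$. $\mathrm{Aff}\,T(\mathcal{A})$ is the real Banach space of real-valued continuous affine functions on $T(\mathcal{A})$ with the uniform norm, and $\mathrm{Aff}\,T(\mathcal{A})_+$ is its set of nonnegative functions. $D(\mathcal{A}\otimes\mathcal{K})$ is the set of Murray-von Neumann equivalence classes of projections of $\mathcal{A}\otimes\mathcal{K}$; a class $[p]$ is identified with the function $\hat p\in\mathrm{Aff}\,T(\mathcal{A})$, $\hat p(\tau)=(\tau\otimes\mathrm{Tr})(p)$. Density of $D(\mathcal{A}\otimes\mathcal{K})$ in $\mathrm{Aff}\,T(\mathcal{A})_+$ means: for every $f\in\mathrm{Aff}\,T(\mathcal{A})_+$ and every $\epsilon>0$ there is a projection $p\in\mathcal{A}\otimes\mathcal{K}$ with $|\hat p(\tau)-f(\tau)|<\epsilon$ for all $\tau\in T(\mathcal{A})$. *)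

(* Defs.v *)
From HB Require Import structures.
From mathcomp Require Import all_boot all_order all_algebra.
From mathcomp Require Import all_classical all_reals all_analysis.
From mathcomp Require Export complex.

Set Implicit Arguments.
Unset Strict Implicit.
Unset Printing Implicit Defensive.

Import Order.TTheory GRing.Theory Num.Theory.
Import numFieldNormedType.Exports.

Local Open Scope classical_set_scope.
Local Open Scope ring_scope.
Local Open Scope complex_scope.

(* A C*-algebra is not required to be unital, which rules out MathComp's ring
   structures for its product.  Norms are valued in the nonnegative elements
   of [R[i]], as for every normed module over [R[i]]. *)
HB.mixin Record isCStarAlgebra (R : realType) A
    of CompleteNormedModule R[i] A := {
  cmul : A -> A -> A;
  star : A -> A;
  cmulA : associative cmul;
  cmulDl : left_distributive cmul +%R;
  cmulDr : right_distributive cmul +%R;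
  cmulZl : forall (c : R[i]) x y, cmul (c *: x) y = c *: cmul x y;
  cmulZr : forall (c : R[i]) x y, cmul x (c *: y) = c *: cmul x y;
  starK : involutive star;
  starD : {morph star : x y / x + y};
  starZ : forall (c : R[i]) x, star (c *: x) = Num.conj c *: star x;
  starM : forall x y, star (cmul x y) = cmul (star y) (star x);
  cnormM : forall x y, `|cmul x y| <= `|x| * `|y|;
  cnorm_star : forall x, `|cmul (star x) x| = `|x| ^+ 2
}.

#[short(type="cstarAlgType")]
HB.structure Definition CStarAlgebra (R : realType) :=
  {A of isCStarAlgebra R A & CompleteNormedModule R[i] A}.

Notation "x ** y" := (cmul x y) (at level 40, left associativity) : ring_scope.

Section CStarAlgebraTheory.
Variables (R : realType) (A : cstarAlgType R).
Implicit Types (a b e p q u v x y : A).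

Definition is_unit u := forall a, u ** a = a /\ a ** u = a.

Definition selfadjoint : set A := [set a | star a = a].

Definition cpositive : set A := [set a | exists b, a = star b ** b].

Definition projections : set A := [set p | star p = p /\ p ** p = p].

Definition mvn_equiv p q := exists v, star v ** v = p /\ v ** star v = q.

Definition mvn_class p : set A := [set q | projections q /\ mvn_equiv p q].

Definition mvn_classes : set (set A) := [set mvn_class p | p in projections].

Definition projection_span : set A :=
  [set a | exists (n : nat) (c : 'I_n -> R[i]) (p : 'I_n -> A),
    (forall i, projections (p i)) /\ a = \sum_i c i *: p i].

Definition closed_ideal (J : set A) :=
  [/\ J 0, (forall x y, J x -> J y -> J (x + y)),
      (forall (c : R[i]) x, J x -> J (c *: x)),
      (forall a x, J x -> J (a ** x) /\ J (x ** a)) & closed J].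

Definition is_simple :=
  (exists a, a != 0) /\
  forall J : set A, closed_ideal J -> J = [set 0] \/ J = setT.

Definition sigma_unital := exists u : nat -> A,
  [/\ forall n, cpositive (u n) /\ `|u n| <= 1,
      forall a, (fun n => u n ** a) @ \oo --> a &
      forall a, (fun n => a ** u n) @ \oo --> a].

Definition invertible_wrt u a := exists b, a ** b = u /\ b ** a = u.

(* [(c, a)] stands for c1 + a.  The C*-norm of the unitization of a non-unital
   C*-algebra induces the product topology. *)
Definition unitization := (R[i]^o * A)%type.

Definition umul (x y : unitization) : unitization :=
  (x.1 * y.1, x.1 *: y.2 + y.1 *: x.2 + x.2 ** y.2).

Definition uselfadjoint : set unitization :=
  [set x | Num.conj x.1 = x.1 /\ star x.2 = x.2].

Definition uinvertible (x : unitization) :=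
  exists y : unitization, umul x y = (1, 0) /\ umul y x = (1, 0).

(* Brown and Pedersen's definition: the invertible self-adjoint elements of the
   algebra (of its unitization if it has no unit) are dense among the
   self-adjoint ones. *)
Definition real_rank_zero :=
  (forall u, is_unit u ->
     selfadjoint `<=` closure [set a | selfadjoint a /\ invertible_wrt u a]) /\
  (~ (exists u, is_unit u) ->
     uselfadjoint `<=` closure [set x | uselfadjoint x /\ uinvertible x]).

(* Only the values of a weight on positive elements are meaningful. *)
Definition tracial_weight (w : A -> \bar R) :=
  [/\ forall a, cpositive a -> (0 <= w a)%E,
      forall a b, cpositive a -> cpositive b -> w (a + b) = (w a + w b)%E,
      forall (r : R) a, 0 <= r -> cpositive a ->
        w (r%:C *: a) = (r%:E * w a)%E &
      forall x, w (x ** star x) = w (star x ** x)].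

Definition lsc_weight (w : A -> \bar R) :=
  forall M : R, closed [set a | cpositive a /\ (w a <= M%:E)%E].

Definition semifinite_weight (w : A -> \bar R) :=
  dense [set a | (w (star a ** a) < +oo)%E].

Definition semifinite_traces : set (A -> \bar R) :=
  [set w | [/\ tracial_weight w, lsc_weight w, semifinite_weight w &
               exists a, cpositive a /\ w a != 0%E]].

Definition corner e : set A := [set a | e ** a ** e = a].

(* The projection e whose corner eAe carries the traces; eAe is A itself if A
   is unital. *)
Definition base_projection e :=
  [/\ projections e, e != 0 & forall u, is_unit u -> e = u].

(* A functional on eAe is represented by its composition with a |-> eae, so
   that pointwise convergence on A is the weak* topology of the dual of eAe. *)
Definition functionals : Type := {ptws A -> R[i]^o}.

Definition tracial_states e : set functionals :=
  [set phi | [/\ scalar (phi : A -> R[i]),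
    forall a, phi (e ** a ** e) = phi a,
    forall x, corner e x -> 0 <= (phi (star x ** x) : R[i]),
    phi e = 1 &
    forall x y, corner e x -> corner e y -> phi (x ** y) = phi (y ** x)]].

Definition convex_comb (r : R) (phi psi : functionals) : functionals :=
  fun a => r%:C * phi a + (1 - r)%:C * psi a.

Definition extreme_points (T : set functionals) : set functionals :=
  [set phi | T phi /\ forall psi1 psi2 (r : R), T psi1 -> T psi2 ->
    0 < r < 1 -> phi = convex_comb r psi1 psi2 -> psi1 = phi /\ psi2 = phi].

Definition continuous_affine (T : set functionals) (f : functionals -> R) :=
  {within T, continuous f} /\
  forall phi psi (r : R), T phi -> T psi -> 0 <= r <= 1 ->
    f (convex_comb r phi psi) = r * f phi + (1 - r) * f psi.

(* The unique extension of a tracial state of eAe, given by definite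
   description. *)
Definition weight_of e (phi : functionals) : A -> \bar R :=
  xget (fun=> 0%E) [set w | semifinite_traces w /\
    forall a, corner e a -> cpositive a -> w a = (complex.Re (phi a))%:E].

End CStarAlgebraTheory.

Arguments mvn_classes {R} A.
Arguments projection_span {R} A.

Section CompactOperators.
Variables (R : realType) (H : completeNormedModType R[i]).
Variable ip : {dot H for Num.conj}.

Definition hilbert_norm := forall v : H, ip v v = `|v| ^+ 2.

(* Such a sequence exists exactly when the Hilbert space is separable and
   infinite-dimensional. *)
Definition orthonormal_basis (xi : nat -> H) :=
  (forall m n, ip (xi m) (xi n) = (m == n)%:R) /\
  (forall v, (forall n, ip v (xi n) = 0) -> v = 0).

Definition compact_operator (k : H -> H) :=
  linear k /\ compact (closure (k @` [set v | `|v| <= 1])).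

Definition is_adjoint (k k' : H -> H) :=
  forall v w, ip (k v) w = ip v (k' w).

Definition positive_operator (k : H -> H) := forall v, 0 <= ip (k v) v.

Definition Tr (xi : nat -> H) (k : H -> H) : \bar R :=
  (\sum_(0 <= n <oo) (complex.Re (ip (k (xi n)) (xi n)))%:E)%E.

End CompactOperators.

Section StableAlgebra.
Variables (R : realType) (A B : cstarAlgType R) (H : completeNormedModType R[i]).
Variable ip : {dot H for Num.conj}.
Variable t : A -> (H -> H) -> B.

(* B is the completion of the algebraic tensor product of A and K for a
   C*-norm, which is unique because K is nuclear; [t a k] is the elementary
   tensor.  The values of [t a] at non-compact operators are irrelevant. *)
Record is_tensor_compact : Prop := {
  tens_linl : forall k, compact_operator k -> linear (t^~ k);
  tens_linr : forall a (c : R[i]) k l,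
    compact_operator k -> compact_operator l ->
    t a (fun v => c *: k v + l v) = c *: t a k + t a l;
  tens_mul : forall a b k l, compact_operator k -> compact_operator l ->
    t a k ** t b l = t (a ** b) (k \o l);
  tens_star : forall a k k', compact_operator k -> compact_operator k' ->
    is_adjoint ip k k' -> star (t a k) = t (star a) k';
  tens_inj : forall n (a : 'I_n -> A) (k : 'I_n -> H -> H),
    (forall i, compact_operator (k i)) ->
    (forall c : 'I_n -> R[i],
       (forall v, \sum_i c i *: k i v = 0) -> forall i, c i = 0) ->
    \sum_i t (a i) (k i) = 0 -> forall i, a i = 0;
  tens_dense : dense [set b : B |
    exists (n : nat) (a : 'I_n -> A) (k : 'I_n -> H -> H),
      (forall i, compact_operator (k i)) /\ b = \sum_i t (a i) (k i)]
}.

Variables (xi : nat -> H) (e : A).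

(* The weight tau (x) Tr, by definite description: on positive elements it is
   the only lower semicontinuous tracial weight with the given values on
   elementary tensors (where 0 * +oo = 0). *)
Definition tensor_trace (phi : functionals A) : B -> \bar R :=
  xget (fun=> 0%E) [set w | [/\ tracial_weight w, lsc_weight w &
    forall a k, cpositive a -> compact_operator k -> positive_operator ip k ->
      w (t a k) = (weight_of e phi a * Tr ip xi k)%E]].

Definition hat (p : B) (phi : functionals A) : \bar R := tensor_trace phi p.

Definition dense_in_Aff_plus :=
  forall f : functionals A -> R, continuous_affine (tracial_states e) f ->
    (forall phi, tracial_states e phi -> 0 <= f phi) ->
    forall eps : R, 0 < eps -> exists2 p : B, projections p &
      forall phi, tracial_states e phi ->
        (`|hat p phi - (f phi)%:E| < eps%:E)%E.

End StableAlgebra.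

(* Main.v *)
Require Import Defs.
From mathcomp Require Import all_boot all_order all_algebra.
From mathcomp Require Import all_classical all_reals all_analysis.
From mathcomp Require Import ring lra.

(* If the projections span [A], then [a |-> (phi |-> phi a)] sends eAe into the
   linear span of the countably many functions [phi |-> phi(q_j)], where the
   [q_j] represent the Murray-von Neumann classes and [phi(q)] is defined for
   every projection [q] through the algebraic ideal AeA, which contains [q].
   For each [n], a nonzero combination [L_n] of [n + 1] distinct extremal traces
   annihilates the first [n] of these functions, so A is the union of the
   closed subspaces [ker L_n].  This contradicts Baire's theorem, because
   distinct extremal traces are linearly independent.

   For the independence, let [Phi] be the sum of finitely many extremal traces
   [f_i], and [T_i] the Radon-Nikodym derivatives, which are commuting positive
   operators on L^2(Phi).  Extremality of [f_i] gives [T_i^2 = c_i T_i] with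
   [c_i > 0], hence [T_i T_j = T_i T_j T_i / c_i] is positive and dominated by
   [T_i], hence a multiple of [T_i], and likewise of [T_j].  Therefore
   [T_i T_j = 0] for [i <> j].  The vectors of L^2(Phi) are replaced below by
   explicit approximations in A. *)

Set Implicit Arguments.
Unset Strict Implicit.
Unset Printing Implicit Defensive.

Import Order.TTheory GRing.Theory Num.Theory.
Import numFieldNormedType.Exports.

Local Open Scope classical_set_scope.
Local Open Scope ring_scope.
Local Open Scope complex_scope.

(** * Quadratic forms and rates of convergence over the reals *)

Section RealLemmas.
Context {R : realType}.

(** For [c > 0] the form is evaluated at its minimizer [- b / c]. A negative [c], or a nonzero [b]
    when [c = 0], would give it a negative value. Besides the Cauchy-Schwarz inequality, this turns
    almost minimality into an estimate in [Riesz_approx]. *)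
Lemma quad_form_discr (a b c : R) :
  (forall r, 0 <= a + 2 * r * b + r ^+ 2 * c) -> b ^+ 2 <= a * c.
Proof.
move=> pos; have a0 : 0 <= a by have := pos 0; lra.
have [c0|c0] := ltP 0 c.
  have := pos (- b / c).
  have -> : a + 2 * (- b / c) * b + (- b / c) ^+ 2 * c = (a * c - b ^+ 2) / c.
    by field; rewrite gt_eqF.
  by rewrite pmulr_lge0 ?invr_gt0// subr_ge0.
have c0' : c = 0.
  apply/eqP; rewrite eq_le c0 leNgt; apply/negP => cN.
  (* This [r] is at least 1 and makes [r * c] smaller than -(2|b| + a + 1), so that the quadratic
     term outweighs the other two. *)
  pose r := (2 * `|b| + a + 1) / (- c) + 1.
  have rc : r * c = - (2 * `|b| + a + 1) + c.
    by rewrite /r; field; rewrite lt_eqF.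
  have r1 : 1 <= r.
    by rewrite lerDr divr_ge0 ?oppr_ge0// addr_ge0// addr_ge0// mulr_ge0.
  have := pos r; have -> : r ^+ 2 * c = r * (r * c) by ring.
  by rewrite rc; have := ler_norm b; nra.
rewrite c0' mulr0 le_eqVlt sqrf_eq0; apply/orP; left; apply/eqP.
apply/eqP; apply: contraT => b0; have := pos (- (a + 1) / (2 * b)).
have -> : a + 2 * (- (a + 1) / (2 * b)) * b +
   (- (a + 1) / (2 * b)) ^+ 2 * c = -1 by rewrite c0'; field.
by rewrite ler0N1.
Qed.

(** A common modulus of convergence: with errors of the form [rate k * K], passing to the limit
    amounts to [le_of_rate] or [eq_of_rate], and the rest is linear arithmetic. *)
Definition rate (n : nat) : R := n.+1%:R^-1.

Lemma rate_gt0 n : 0 < rate n.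
Proof. by rewrite invr_gt0 ltr0n. Qed.

Lemma rate_ge0 n : 0 <= rate n.
Proof. exact: ltW (rate_gt0 n). Qed.

Lemma rate_le1 n : rate n <= 1.
Proof. by rewrite invf_le1 ?ltr0n// ler1n. Qed.

Lemma le_rate m n : (m <= n)%N -> rate n <= rate m.
Proof. by move=> mn; rewrite lef_pV2 ?posrE ?ltr0n// ler_nat ltnS. Qed.

Lemma rate_small (c eps : R) : 0 < eps ->
  exists m, forall n, (m <= n)%N -> rate n * c <= eps.
Proof.
move=> eps0; exists (Num.truncn (`|c| / eps)) => n mn.
rewrite (le_trans (ler_wpM2l (rate_ge0 n) (ler_norm c)))//.
rewrite mulrC ler_pdivrMr ?ltr0n// mulrC -ler_pdivrMr// ltW//.
by rewrite (lt_le_trans (truncnS_gt _))// ler_nat ltnS.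
Qed.

Lemma rate_small2 (c d eps : R) (k : nat) : 0 < eps -> exists n,
  [/\ (k <= n)%N, rate n * c <= eps & rate n * d <= eps].
Proof.
move=> eps0; have [m1 H1] := rate_small c eps0.
have [m2 H2] := rate_small d eps0.
exists (maxn k (maxn m1 m2)); rewrite H1 ?H2 ?leq_maxl//.
  by rewrite (leq_trans (leq_maxr m1 m2))// leq_maxr.
by rewrite (leq_trans (leq_maxl m1 m2))// leq_maxr.
Qed.

Lemma le_of_rate (x y c : R) : (forall n, x <= y + rate n * c) -> x <= y.
Proof.
move=> H; apply/ler_addgt0Pr => eps eps0.
have [m Hm] := rate_small c eps0.
by rewrite (le_trans (H m))// lerD2l Hm.
Qed.

Lemma eq_of_rate (x y c : R) : (forall n, `|x - y| <= rate n * c) -> x = y.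
Proof.
move=> H; apply/eqP; rewrite -subr_eq0 -normr_le0.
by apply: (@le_of_rate _ _ c) => n; rewrite add0r.
Qed.

Lemma cauchy_rate_limit (u : nat -> R) (c : R) :
  (forall m n, `|u m - u n| <= (rate m + rate n) * c) ->
  exists l, forall n, `|u n - l| <= rate n * c.
Proof.
move=> uC.
have cvu : cvgn u.
  apply/cauchy_cvgP/cauchy_exP => eps eps0.
  have [m Hm] := rate_small (2 * `|c|) (divr_gt0 eps0 (ltr0n R 2)).
  exists (u m); exists m => // n /= mn; rewrite /ball /=.
  have c1 : (rate m + rate n) * c <= (rate m + rate n) * `|c|.
    by rewrite ler_wpM2l ?ler_norm// addr_ge0 ?rate_ge0.
  have c2 : (rate m + rate n) * `|c| <= (rate m + rate m) * `|c|.
    by rewrite ler_wpM2r// lerD2l le_rate.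
  by have := uC m n; have := Hm m (leqnn m); lra.
exists (limn u) => n; apply/ler_addgt0Pr => eps eps0.
have [m _ Hm] := (iffLR (cvgrPdist_lt _ _) cvu) (eps / 2) (divr_gt0 eps0 (ltr0n R 2)).
have [l [kl lc _]] := rate_small2 c 0 m (divr_gt0 eps0 (ltr0n R 2)).
have H1 : `|limn u - u l| < eps / 2 by exact: Hm.
have := uC n l; rewrite mulrDl.
have := ler_distD (u l) (u n) (limn u); rewrite (distrC (u l)); lra.
Qed.

End RealLemmas.

(** * Tracial functionals *)

Section CStarBasics.
Context {R : realType} {A : cstarAlgType R}.
Implicit Types x y z : A.

Lemma cmul0l x : 0 ** x = 0.
Proof. by apply: (@addrI _ (0 ** x)); rewrite -cmulDl !addr0. Qed.

Lemma cmul0r x : x ** 0 = 0.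
Proof. by apply: (@addrI _ (x ** 0)); rewrite -cmulDr !addr0. Qed.

Lemma star0 : star (0 : A) = 0.
Proof. by apply: (@addrI _ (star 0)); rewrite -starD !addr0. Qed.

Lemma cmulNl x y : - x ** y = - (x ** y).
Proof. by apply: (@addrI _ (x ** y)); rewrite -cmulDl !subrr cmul0l. Qed.

Lemma cmulNr x y : x ** - y = - (x ** y).
Proof. by apply: (@addrI _ (x ** y)); rewrite -cmulDr !subrr cmul0r. Qed.

Lemma starN x : star (- x) = - star x.
Proof. by apply: (@addrI _ (star x)); rewrite -starD !subrr star0. Qed.

Lemma cmulBl x y z : (x - y) ** z = x ** z - y ** z.
Proof. by rewrite cmulDl cmulNl. Qed.

Lemma cmulBr x y z : x ** (y - z) = x ** y - x ** z.
Proof. by rewrite cmulDr cmulNr. Qed.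

Lemma starB x y : star (x - y) = star x - star y.
Proof. by rewrite starD starN. Qed.

Lemma starZr (r : R) x : star (r%:C *: x) = r%:C *: star x.
Proof. by rewrite starZ; congr (_ *: _); exact: conjc_real. Qed.

End CStarBasics.

Section Traces.
Context {R : realType} {A : cstarAlgType R} (e : A).

(* Compressing the product by [e] makes every trace of the corner eAe a trace
   on all of [A], so that no membership in the corner has to be tracked. *)
Definition emul (x y : A) : A := x ** e ** y.
Local Notation "x ⋆ y" := (emul x y) (at level 40, left associativity).

(** These are the real parts of positive traces on eAe, composed with a |-> eae. They keep every
    estimate in the ordered field [R], and [cplx_state] recovers the complex functional. *)
Record rtrace (f : A -> R) : Prop := {
  rtraceD : forall x y, f (x + y) = f x + f y;
  rtraceZ : forall (r : R) x, f (r%:C *: x) = r * f x;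
  rtraceE : forall x, f (e ** x ** e) = f x;
  rtrace_star : forall x, f (star x) = f x;
  rtraceC : forall x y, f (x ⋆ y) = f (y ⋆ x);
  rtrace_ge0 : forall x, 0 <= f (star x ⋆ x) }.

Context (e_proj : projections e).

Lemma emulA x y z : x ⋆ (y ⋆ z) = x ⋆ y ⋆ z.
Proof. by rewrite /emul !cmulA. Qed.

Lemma emulDl x y z : (x + y) ⋆ z = x ⋆ z + y ⋆ z.
Proof. by rewrite /emul !cmulDl. Qed.

Lemma emulDr x y z : x ⋆ (y + z) = x ⋆ y + x ⋆ z.
Proof. by rewrite /emul !cmulDr. Qed.

Lemma emulBl x y z : (x - y) ⋆ z = x ⋆ z - y ⋆ z.
Proof. by rewrite /emul !cmulBl. Qed.

Lemma emulBr x y z : x ⋆ (y - z) = x ⋆ y - x ⋆ z.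
Proof. by rewrite /emul !cmulBr. Qed.

Lemma emulZl (c : R[i]) x y : (c *: x) ⋆ y = c *: (x ⋆ y).
Proof. by rewrite /emul !cmulZl. Qed.

Lemma emulZr (c : R[i]) x y : x ⋆ (c *: y) = c *: (x ⋆ y).
Proof. by rewrite /emul !cmulZr. Qed.

Lemma star_emul x y : star (x ⋆ y) = star y ⋆ star x.
Proof. by rewrite /emul !starM e_proj.1 cmulA. Qed.

Lemma star_base : star e = e. Proof. exact: e_proj.1. Qed.

Section OneTrace.
Context (f : A -> R) (ft : rtrace f).

Lemma rtraceN x : f (- x) = - f x.
Proof.
have f0 : f 0 = 0 by apply: (@addrI _ (f 0)); rewrite -(rtraceD ft) !addr0.
by apply: (@addrI _ (f x)); rewrite -(rtraceD ft) !subrr.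
Qed.

Lemma rtraceB x y : f (x - y) = f x - f y.
Proof. by rewrite (rtraceD ft) rtraceN. Qed.

Lemma rtrace_mul1 x : f (e ⋆ x) = f x.
Proof. by rewrite -(rtraceE ft) -[RHS](rtraceE ft) /emul !cmulA !e_proj.2. Qed.

(** The real part of the GNS inner product of the trace. The completion is never formed: [snorm] is
    only a seminorm on [A]. *)
Definition dot x y := f (star x ⋆ y).
Definition snorm x := Num.sqrt (dot x x).

Lemma dotC x y : dot x y = dot y x.
Proof. by rewrite /dot -(rtrace_star ft) star_emul starK. Qed.

Lemma dotDr x y z : dot x (y + z) = dot x y + dot x z.
Proof. by rewrite /dot emulDr (rtraceD ft). Qed.

Lemma dotDl x y z : dot (x + y) z = dot x z + dot y z.
Proof. by rewrite dotC dotDr !(dotC z). Qed.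

Lemma dotZr (r : R) x y : dot x (r%:C *: y) = r * dot x y.
Proof. by rewrite /dot emulZr (rtraceZ ft). Qed.

Lemma dotZl (r : R) x y : dot (r%:C *: x) y = r * dot x y.
Proof. by rewrite dotC dotZr dotC. Qed.

Lemma dot_ge0 x : 0 <= dot x x. Proof. exact: (rtrace_ge0 ft). Qed.

Lemma snorm_ge0 x : 0 <= snorm x. Proof. exact: sqrtr_ge0. Qed.

Lemma sqr_snorm x : snorm x ^+ 2 = dot x x.
Proof. exact: sqr_sqrtr (dot_ge0 x). Qed.

Lemma dot_quad x y (r : R) :
  dot (x + r%:C *: y) (x + r%:C *: y) = dot x x + 2 * r * dot x y + r ^+ 2 * dot y y.
Proof. by rewrite dotDr !dotDl !dotZr !dotZl (dotC y x); ring. Qed.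

Lemma dot_CauchySchwarz x y : `|dot x y| <= snorm x * snorm y.
Proof.
have : dot x y ^+ 2 <= dot x x * dot y y.
  by apply: quad_form_discr => r; rewrite -dot_quad dot_ge0.
rewrite -!sqr_snorm -exprMn -[_ ^+ 2]real_normK ?num_real//.
by rewrite ler_pXn2r ?nnegrE ?normr_ge0 ?mulr_ge0 ?snorm_ge0.
Qed.

Lemma snormD x y : snorm (x + y) <= snorm x + snorm y.
Proof.
rewrite -(@ler_pXn2r _ 2) ?nnegrE ?addr_ge0 ?snorm_ge0// sqr_snorm.
rewrite dotDr !dotDl -!sqr_snorm (dotC y x).
have := le_trans (ler_norm _) (dot_CauchySchwarz x y); nra.
Qed.

Lemma snorm_star x : snorm (star x) = snorm x.
Proof. by rewrite /snorm /dot starK (rtraceC ft). Qed.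

Lemma snormN x : snorm (- x) = snorm x.
Proof. by rewrite /snorm /dot starN /emul cmulNl !cmulNr cmulNl opprK. Qed.

Lemma snormB x y : snorm (x - y) <= snorm x + snorm y.
Proof. by rewrite (le_trans (snormD _ _))// snormN. Qed.

Lemma rtrace_bound x y : `|f (x ⋆ y)| <= snorm x * snorm y.
Proof. by rewrite -{1}(starK x) -(snorm_star x) dot_CauchySchwarz. Qed.

Lemma rtrace_le x : `|f x| <= snorm e * snorm x.
Proof. by rewrite -{1}rtrace_mul1 rtrace_bound. Qed.

End OneTrace.

End Traces.

(** * Norms and square roots *)

Section ComplexModulus.
Context {R : realType}.

Lemma re_normE (z : R[i]) : `|z| = (complex.Re `|z|)%:C.
Proof. by rewrite RRe_real// normr_real. Qed.

Lemma re_norm_ge0 (z : R[i]) : 0 <= complex.Re `|z|.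
Proof. by rewrite -ler0c -re_normE normr_ge0. Qed.

Lemma re_norm_gt0 (z : R[i]) : z != 0 -> 0 < complex.Re `|z|.
Proof. by rewrite -ltcR -re_normE normr_gt0. Qed.

Lemma re_normM (z w : R[i]) : complex.Re `|z * w| = complex.Re `|z| * complex.Re `|w|.
Proof. by apply: complexI; rewrite rmorphM /= -!re_normE normrM. Qed.

Lemma re_norm_sum (I : Type) (l : seq I) (F : I -> R[i]) :
  complex.Re `|\sum_(i <- l) F i| <= \sum_(i <- l) complex.Re `|F i|.
Proof.
elim: l => [|i l IH]; first by rewrite !big_nil normr0.
rewrite !big_cons (le_trans _ (lerD (lexx _) IH))//.
have := ler_normD (F i) (\sum_(j <- l) F j).
by rewrite lecE => /andP[_]; rewrite raddfD.
Qed.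

End ComplexModulus.

Section RealNorm.
Context {R : realType} {A : cstarAlgType R}.
Implicit Types x y z : A.

Definition nrm x : R := complex.Re `|x|.

Lemma nrmE x : `|x| = (nrm x)%:C.
Proof. by rewrite /nrm RRe_real// normr_real. Qed.

Lemma nrm_ge0 x : 0 <= nrm x.
Proof. by rewrite -ler0c -nrmE normr_ge0. Qed.

Lemma nrm0 : nrm (0 : A) = 0.
Proof. by rewrite /nrm normr0. Qed.

Lemma nrm_eq0 x : nrm x = 0 -> x = 0.
Proof. by move=> x0; apply/normr0_eq0; rewrite nrmE x0. Qed.

Lemma nrmD x y : nrm (x + y) <= nrm x + nrm y.
Proof. rewrite -lecR rmorphD /= -!nrmE; exact: ler_normD. Qed.

Lemma nrm_distC x y : nrm (x - y) = nrm (y - x).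
Proof. by rewrite /nrm distrC. Qed.

Lemma nrm_dist z x y : nrm (x - y) <= nrm (x - z) + nrm (z - y).
Proof. rewrite -lecR rmorphD /= -!nrmE; exact: ler_distD. Qed.

Lemma nrmM x y : nrm (x ** y) <= nrm x * nrm y.
Proof. rewrite -lecR rmorphM /= -!nrmE; exact: cnormM. Qed.

Lemma nrmZ (c : R[i]) x : nrm (c *: x) = complex.Re `|c| * nrm x.
Proof.
by apply: complexI; rewrite -nrmE normrZ nrmE rmorphM /= -re_normE.
Qed.

Lemma nrmZr (r : R) x : nrm (r%:C *: x) = `|r| * nrm x.
Proof. by rewrite nrmZ normc_def /= expr0n addr0 sqrtr_sqr. Qed.

(** The C*-identity and submultiplicativity give [nrm y <= nrm (star y)], which is then also applied
    to [star x]. *)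
Lemma nrm_star x : nrm (star x) = nrm x.
Proof.
have le y : nrm y <= nrm (star y).
  have [->|y0] := eqVneq (nrm y) 0; first exact: nrm_ge0.
  have y0' : 0 < nrm y by rewrite lt_neqAle eq_sym y0 nrm_ge0.
  rewrite -(ler_pM2r y0') (le_trans _ (nrmM _ _))// -expr2.
  by rewrite -lecR -nrmE cnorm_star nrmE rmorphXn.
by apply/eqP; rewrite eq_le le andbT -{2}(starK x) le.
Qed.

Lemma nrm_projection p : projections p -> nrm p <= 1.
Proof.
move=> [ps pp]; have [->|p0] := eqVneq (nrm p) 0 => //.
have p0' : 0 < nrm p by rewrite lt_neqAle eq_sym p0 nrm_ge0.
rewrite -(ler_pM2r p0') mul1r -expr2 -lecR rmorphXn /= -!nrmE -cnorm_star.
by rewrite ps pp.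
Qed.

Lemma nrm_small x : (forall eps : R, 0 < eps -> nrm x <= eps) -> x = 0.
Proof.
move=> H; apply: nrm_eq0; apply/eqP; rewrite eq_le nrm_ge0 andbT.
by apply/ler_addgt0Pr => eps /H; rewrite add0r.
Qed.

Lemma gt0_complex (z : R[i]) : 0 < z -> exists2 r : R, 0 < r & z = r%:C.
Proof.
move=> z0; have zE : z = (complex.Re z)%:C by rewrite RRe_real// gtr0_real.
by exists (complex.Re z) => //; rewrite -ltcR -zE.
Qed.

Lemma nbhs_nrm x (S : set A) :
  nbhs x S <-> exists2 r : R, 0 < r & forall y, nrm (x - y) < r -> S y.
Proof.
split.
  move=> /nbhs_ballP[z /= /gt0_complex[r r0 ->]] H; exists r => // y xy.
  by apply: H; rewrite -ball_normE /= nrmE ltcR.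
move=> [r r0 H]; apply/nbhs_ballP; exists r%:C; first by rewrite /= ltcR.
by move=> y; rewrite -ball_normE /= nrmE ltcR; exact: H.
Qed.

Lemma closure_nrm (S : set A) x :
  closure S x <-> forall r : R, 0 < r -> exists2 y, S y & nrm (x - y) < r.
Proof.
split.
  move=> Sx r r0; have [|y [Sy xy]] := Sx [set y | nrm (x - y) < r].
    by apply/nbhs_nrm; exists r.
  by exists y.
move=> H B /nbhs_nrm[r r0 Br]; have [y Sy xy] := H _ r0.
by exists y; split => //; exact: Br.
Qed.

Lemma cvg_nrm (u : nat -> A) l : u @ \oo --> l -> forall r : R, 0 < r ->
  exists N, forall n, (N <= n)%N -> nrm (u n - l) < r.
Proof.
move=> ul r r0; have : nbhs l [set y | nrm (l - y) < r].
  by apply/nbhs_nrm; exists r.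
by move=> /ul[N _ HN]; exists N => n /HN /=; rewrite nrm_distC.
Qed.

Lemma complete_rate (u : nat -> A) (c : R) :
  (forall m n, (m <= n)%N -> nrm (u n - u m) <= rate m * c) ->
  exists l, forall m, nrm (l - u m) <= rate m * c.
Proof.
move=> uC.
have cvu : cvgn u.
  apply/cauchy_cvgP/cauchy_exP => z /gt0_complex[r r0 ->].
  have [m Hm] := rate_small (2 * c) r0.
  exists (u m); exists m => // n /= mn.
  rewrite -ball_normE /= nrmE ltcR nrm_distC.
  have [c0|c0] := ltP 0 (rate m * c).
    by have := uC _ _ mn; have := Hm m (leqnn m); lra.
  by rewrite (le_lt_trans (uC _ _ mn))// (le_lt_trans c0).
exists (limn u) => m; apply/ler_addgt0Pr => r r0.
have [N HN] := cvg_nrm cvu r0.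
have H1 := HN (maxn N m) (leq_maxl _ _); rewrite nrm_distC in H1.
have H2 := uC m (maxn N m) (leq_maxr _ _).
by have := nrm_dist (u (maxn N m)) (limn u) (u m); lra.
Qed.

(** This fixed point theorem takes the place of functional calculus: it produces a square root of
    [e - x], and later an inverse in the corner of a projection. *)
Lemma contraction_fixpoint (T : A -> A) (D : set A) (x0 : A) : D x0 ->
  closure D `<=` D -> (forall x, D x -> D (T x)) ->
  (forall x y, D x -> D y -> nrm (T x - T y) <= 2^-1 * nrm (x - y)) ->
  exists2 p, D p & T p = p.
Proof.
move=> Dx0 Dcl DT lip; pose u n := iter n T x0.
have Du n : D (u n) by elim: n => //= n; exact: DT.
pose C := nrm (T x0 - x0); have C0 : 0 <= C by exact: nrm_ge0.
have step n : nrm (u n.+1 - u n) <= 2^-1 ^+ n * C.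
  elim: n => [|n IH]; first by rewrite mul1r.
  rewrite (le_trans (lip _ _ (Du n.+1) (Du n)))// exprS -mulrA.
  by rewrite ler_wpM2l ?invr_ge0.
(* The right-hand side is the sum of the geometric bounds for the [k] steps that start at [m]. *)
have far m k : nrm (u (m + k)%N - u m) <= 2 * 2^-1 ^+ m * C * (1 - 2^-1 ^+ k).
  elim: k => [|k IH]; first by rewrite addn0 subrr nrm0 expr0 subrr mulr0.
  have H := step (m + k)%N; rewrite exprD in H.
  have := nrm_dist (u (m + k)%N) (u (m + k.+1)%N) (u m).
  rewrite addnS => H1; apply: (le_trans H1); apply: (le_trans (lerD H IH)).
  by rewrite exprS le_eqVlt; apply/orP; left; apply/eqP; field.
have half n : 0 <= (2^-1 : R) ^+ n <= rate n.
  rewrite exprn_ge0 ?invr_ge0//= exprVn lef_pV2 ?posrE ?ltr0n ?exprn_gt0//.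
  by rewrite -natrX ler_nat ltn_expl.
have uC m n : (m <= n)%N -> nrm (u n - u m) <= rate m * (2 * C).
  move=> mn; rewrite -(subnKC mn) (le_trans (far _ _))//.
  have /andP[a0 a1] := half m; have /andP[b0 _] := half (n - m)%N.
  have : 2^-1 ^+ m * C <= rate m * C by rewrite ler_wpM2r.
  have : 0 <= 2^-1 ^+ m * C by rewrite mulr_ge0.
  nra.
have [l lu] := complete_rate uC.
have Dl : D l.
  apply: Dcl; apply/closure_nrm => r r0.
  have [m Hm] := rate_small (2 * C) (divr_gt0 r0 (ltr0n R 2)).
  exists (u m) => //; rewrite (le_lt_trans (lu m))//.
  by rewrite (le_lt_trans (Hm m _))//; lra.
exists l => //; apply/eqP; rewrite -subr_eq0; apply/eqP.
apply: nrm_small => r r0.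
have [m Hm] := rate_small (2 * C) (divr_gt0 r0 (ltr0n R 2)).
have H1 := lip _ _ Dl (Du m); have H2 := lu m; have H3 := lu m.+1.
have H4 := Hm m (leqnn m); have H5 := Hm m.+1 (leqnSn m).
have := nrm_dist (u m.+1) (T l) l; rewrite (nrm_distC (u m.+1)).
have : nrm (T l - u m.+1) <= 2^-1 * nrm (l - u m) by exact: H1.
by have := nrm_ge0 (l - u m); lra.
Qed.

End RealNorm.

Section SquareRoot.
Context {R : realType} {A : cstarAlgType R} (e : A) (e_proj : projections e).
Implicit Types x y z : A.

Lemma corner_mul x : corner e x -> e ** x = x /\ x ** e = x.
Proof.
by move=> <-; rewrite !cmulA e_proj.2 -!cmulA e_proj.2.
Qed.

(** With [y = e - z], the equation becomes [z = (x + z ** z) / 2]. The right-hand side is a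
    contraction of the ball of radius 1/2, which it preserves because (3/4 + 1/4) / 2 = 1/2. *)
Lemma base_minus_square x : star x = x -> corner e x -> nrm x <= 3 / 4 ->
  exists y, [/\ star y = y, corner e y & y ** y = e - x].
Proof.
move=> xs xe xn.
pose D := [set z : A | [/\ nrm z <= 2^-1, star z = z & corner e z]].
pose T z := (2^-1)%:C *: (x + z ** z).
have h0 : `|2^-1 : R| = 2^-1 by rewrite ger0_norm ?invr_ge0.
have [||||z [zn zs ze] Tz] := @contraction_fixpoint _ _ T D 0.
- by split; rewrite ?nrm0 ?invr_ge0 ?star0// /corner /= cmul0r cmul0l.
- move=> z /closure_nrm Dz; split.
  + apply/ler_addgt0Pr => r /Dz[y [yn _ _] zy].
    by have := nrm_dist y z 0; rewrite !subr0; lra.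
  + apply/eqP; rewrite -subr_eq0; apply/eqP/nrm_small => r r0.
    have [y [_ ys _] zy] := Dz _ (divr_gt0 r0 (ltr0n R 2)).
    have := nrm_dist y (star z) z; rewrite -{1}ys -starB nrm_star.
    by rewrite (nrm_distC y); lra.
  + apply/eqP; rewrite -subr_eq0; apply/eqP/nrm_small => r r0.
    have [y [_ _ ye] zy] := Dz _ (divr_gt0 r0 (ltr0n R 2)).
    have := nrm_dist y (e ** z ** e) z; rewrite -{1}ye -cmulBl -cmulBr.
    have e1 := nrm_projection e_proj; have e0 := nrm_ge0 e.
    have : nrm (e ** (z - y) ** e) <= nrm (z - y).
      rewrite (le_trans (nrmM _ _))//.
      rewrite (le_trans (ler_piMr (nrm_ge0 _) e1))// (le_trans (nrmM _ _))//.
      by rewrite ler_piMl ?nrm_ge0.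
    by rewrite (nrm_distC y); lra.
- move=> z [zn zs ze]; split.
  + rewrite nrmZr h0; have := nrmD x (z ** z); have := nrmM z z.
    by have := nrm_ge0 z; nra.
  + by rewrite starZr starD starM zs xs.
  + rewrite /corner /= cmulZr cmulZl cmulDr cmulDl xe.
    have [ze1 ze2] := corner_mul ze.
    by rewrite !cmulA ze1 -!cmulA ze2.
- move=> z w [zn _ _] [wn _ _]; rewrite /T -scalerBr nrmZr h0.
  rewrite ler_wpM2l ?invr_ge0//.
  have -> : x + z ** z - (x + w ** w) = z ** (z - w) + (z - w) ** w.
    by rewrite opprD addrACA subrr add0r cmulBr cmulBl addrA subrK.
  have := nrmD (z ** (z - w)) ((z - w) ** w); have := nrmM z (z - w).
  have := nrmM (z - w) w; have := nrm_ge0 (z - w).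
  nra.
have [ze1 ze2] := corner_mul ze.
exists (e - z); split.
- by rewrite starB zs e_proj.1.
- by rewrite /corner /= cmulBr cmulBl ze !e_proj.2.
have zz : z ** z = z + z - x.
  apply: (canRL (addrK _)); rewrite addrC -[in RHS]Tz -scalerDl -rmorphD /=.
  have -> : 2^-1 + 2^-1 = 1 :> R by field.
  by rewrite scale1r.
rewrite cmulBr !cmulBl e_proj.2 ze1 ze2 zz.
have key (V : zmodType) (a b c : V) : a - b - (b - (b + b - c)) = a - c.
  by rewrite opprB (addrAC (b + b)) addrK addrA subrK.
exact: key.
Qed.

(** Scale [a] to an element [b] of norm 1/2. Then w = e b* e b e is small enough for [e - w] to be a
    square [y ** y], and the difference of the squared seminorms of [x] and [emul e b x] is that of
    [emul e y x], hence nonnegative. The factor 2 is the price of this scaling. *)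
Lemma snorm_emul f a x : rtrace e f ->
  snorm e f (emul e a x) <= 2 * nrm a * snorm e f x.
Proof.
move=> ft; have [/nrm_eq0 ->|a0] := eqVneq (nrm a) 0.
  by rewrite nrm0 mulr0 mul0r /snorm /dot /emul !cmul0l !cmul0r -(subrr 0)
    (rtraceB ft) subrr sqrtr0.
have a0' : 0 < nrm a by rewrite lt_neqAle eq_sym a0 nrm_ge0.
pose r := (2 * nrm a)^-1; have r0 : 0 < r by rewrite invr_gt0 mulr_gt0.
pose b := r%:C *: a.
have bn : nrm b = 2^-1.
  by rewrite nrmZr gtr0_norm// /r invfM mulfVK.
pose w := e ** star b ** e ** b ** e.
have [|||y [ys ye yy]] := @base_minus_square w.
- by rewrite /w !starM starK e_proj.1 !cmulA.
- by rewrite /corner /= /w !cmulA e_proj.2 -!cmulA e_proj.2.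
- have e1 := nrm_projection e_proj; have e0 := nrm_ge0 e.
  have le1 u : nrm (u ** e) <= nrm u.
    by rewrite (le_trans (nrmM _ _))// ler_piMr ?nrm_ge0.
  have le2 u : nrm (u ** b) <= nrm u * 2^-1.
    by rewrite (le_trans (nrmM _ _))// bn.
  have le3 : nrm (e ** star b) <= 2^-1.
    by rewrite (le_trans (nrmM _ _))// nrm_star bn ler_piMl ?invr_ge0.
  have := le1 (e ** star b ** e ** b); have := le2 (e ** star b ** e).
  have := le1 (e ** star b); rewrite -/w; lra.
have [ye1 ye2] := corner_mul ye.
have : dot e f (emul e b x) (emul e b x) <= dot e f x x.
  rewrite -subr_ge0 /dot -(rtraceB ft).
  have := dot_ge0 ft (emul e y x); rewrite /dot !(star_emul e_proj) ys /emul.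
  have -> : star x ** e ** y ** e ** (y ** e ** x) = star x ** e ** (y ** y) ** e ** x.
    by rewrite !cmulA -!(cmulA _ y e) ye2.
  rewrite yy cmulBr !cmulBl /w !cmulA -!(cmulA _ e e) e_proj.2.
  by rewrite -!cmulA (cmulA e e) e_proj.2.
move=> H; have : r * snorm e f (emul e a x) <= snorm e f x.
  have -> : r * snorm e f (emul e a x) = snorm e f (emul e b x).
    rewrite /snorm /b emulZl (dotZl e_proj ft) (dotZr ft) mulrA -expr2.
    by rewrite sqrtrM ?sqr_ge0// sqrtr_sqr gtr0_norm.
  by rewrite ler_wsqrtr.
by rewrite /r mulrC ler_pdivrMr ?mulr_gt0// mulrC.
Qed.

Lemma rtrace_nrm f a : rtrace e f -> `|f a| <= 2 * nrm a * f e.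
Proof.
move=> ft; rewrite -(rtrace_mul1 e_proj ft) (rtraceC ft).
have -> : f (emul e a e) = dot e f e (emul e a e).
  by rewrite /dot (star_base e_proj) (rtrace_mul1 e_proj ft).
rewrite (le_trans (dot_CauchySchwarz e_proj ft _ _))//.
rewrite (le_trans (ler_wpM2l (snorm_ge0 _ _ _) (snorm_emul _ _ ft)))//.
rewrite mulrCA -expr2 (sqr_snorm ft) /dot (star_base e_proj).
by rewrite (rtrace_mul1 e_proj ft).
Qed.

End SquareRoot.

(** * Linear independence of extremal traces *)

Section RadonNikodym.
Context {R : realType} {A : cstarAlgType R} (e : A) (e_proj : projections e).
Local Notation "x ⋆ y" := (emul e x y) (at level 40, left associativity).
Local Notation sn := (@snorm R A e).

(** One constant serves all traces, so it can be used for [Phi], [f] and [g] together. Right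
    multiplication reduces to left multiplication because [star] preserves the seminorms. *)
Lemma emul_bounded a : exists K : R, 0 <= K /\ forall f, rtrace e f ->
  forall x, sn f (a ⋆ x) <= K * sn f x /\ sn f (x ⋆ a) <= K * sn f x.
Proof.
exists (2 * nrm a); split; first by rewrite mulr_ge0 ?nrm_ge0.
move=> f ft x; split; first exact: snorm_emul.
rewrite -(snorm_star ft (x ⋆ a)) (star_emul e_proj) -nrm_star -(snorm_star ft x).
exact: snorm_emul.
Qed.

Definition dominated (f g : A -> R) := forall x, dot e f x x <= dot e g x x.

Lemma le_snorm f g x : dominated f g -> sn f x <= sn g x.
Proof. by move=> fg; rewrite ler_wsqrtr. Qed.

(** In the Hilbert space of [Phi], the [h k] converge to the vector that represents [f], which is
    the Radon-Nikodym derivative T_f applied to the class of [e]. *)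
Definition approx (Phi f : A -> R) (h : nat -> A) := forall k,
  star (h k) = h k /\ forall b, `|Phi (h k ⋆ b) - f b| <= rate k * sn Phi b.

Context (Phi : A -> R) (Phit : rtrace e Phi).

(* Riesz representation in the (uncompleted) Hilbert space of [Phi]: an almost
   minimizer [h] of the quadratic functional below almost represents [f]. *)
Lemma Riesz_approx f (eps : R) : rtrace e f -> dominated f Phi -> 0 < eps ->
  exists h, star h = h /\ forall b, `|Phi (h ⋆ b) - f b| <= eps * sn Phi b.
Proof.
move=> ft fPhi eps0.
pose Q h := dot e Phi h h - 2 * f h.
pose S := [set Q h | h in setT].
(* Completing the square, since [f h <= sn f e * sn Phi h]. *)
have Qlb h : - (sn f e) ^+ 2 <= Q h.
  rewrite /Q -(sqr_snorm Phit).
  have H := le_trans (ler_norm _) (rtrace_le e_proj ft h).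
  have H1 := le_snorm h fPhi; have H2 := snorm_ge0 e f e.
  have H3 : sn f e * sn f h <= sn f e * sn Phi h by rewrite ler_wpM2l.
  have : 0 <= (sn Phi h - sn f e) ^+ 2 by exact: sqr_ge0.
  nra.
have hinf : has_inf S.
  split; first by exists (Q 0), 0.
  by exists (- (sn f e) ^+ 2) => _ [h _ <-]; exact: Qlb.
have [_ [h0 _ <-] Qh0] := inf_adherent (exprn_gt0 2 eps0) hinf.
(* As [h0] minimizes [Q] up to [eps ^+ 2], adding [eps ^+ 2] to the variation of [Q] along
   [h0 + r b] gives a nonnegative quadratic form in [r]. Its discriminant is the claim. *)
have h0P b : `|dot e Phi h0 b - f b| <= eps * sn Phi b.
  have : (dot e Phi h0 b - f b) ^+ 2 <= eps ^+ 2 * dot e Phi b b.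
    apply: quad_form_discr => r.
    have : inf S <= Q (h0 + r%:C *: b).
      by apply: ge_inf; [case: hinf | exists (h0 + r%:C *: b)].
    rewrite /Q (dot_quad e_proj Phit) (rtraceD ft) (rtraceZ ft).
    move: Qh0; rewrite {1}/Q; lra.
  rewrite -(sqr_snorm Phit) -exprMn -[_ ^+ 2]real_normK ?num_real//.
  by rewrite ler_pXn2r ?nnegrE ?normr_ge0 ?mulr_ge0 ?snorm_ge0// ltW.
(* The estimate holds for [star h0] too, so the self-adjoint average satisfies it. *)
exists ((2^-1)%:C *: (h0 + star h0)); split.
  by rewrite starZr starD starK addrC.
move=> b; rewrite emulZl emulDl (rtraceZ Phit) (rtraceD Phit).
have H1 := h0P b; have H2 := h0P (star b).
rewrite (snorm_star Phit) (rtrace_star ft) in H2.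
have E1 : Phi (star h0 ⋆ b) = dot e Phi h0 b by [].
have E2 : Phi (h0 ⋆ b) = dot e Phi h0 (star b).
  rewrite /dot -(rtrace_star Phit) (star_emul e_proj).
  by rewrite (rtraceC Phit).
rewrite E1 E2.
have -> : 2^-1 * (dot e Phi h0 (star b) + dot e Phi h0 b) - f b =
  2^-1 * ((dot e Phi h0 (star b) - f b) + (dot e Phi h0 b - f b)) by field.
rewrite normrM ger0_norm ?invr_ge0//.
have := ler_normD (dot e Phi h0 (star b) - f b) (dot e Phi h0 b - f b); lra.
Qed.

Lemma approx_exists f : rtrace e f -> dominated f Phi -> exists h, approx Phi f h.
Proof.
move=> ft fPhi.
by have [h hP] := choice (fun k => Riesz_approx ft fPhi (rate_gt0 k)); exists h.
Qed.

Section Approx.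
Context (f : A -> R) (ft : rtrace e f) (fPhi : dominated f Phi).
Context (h : nat -> A) (fh : approx Phi f h).

Lemma approx_star k : star (h k) = h k. Proof. by case: (fh k). Qed.

Lemma approxP k b : `|Phi (h k ⋆ b) - f b| <= rate k * sn Phi b.
Proof. by case: (fh k). Qed.

(** The approximation property is tested against [h k] itself and the result divided by its
    seminorm. The next two lemmas do the same with a difference and with a commutator. *)
Lemma approx_bounded k : sn Phi (h k) <= sn f e + 1.
Proof.
have [->|n0] := eqVneq (sn Phi (h k)) 0; first by rewrite addr_ge0 ?snorm_ge0.
have n0' : 0 < sn Phi (h k) by rewrite lt_neqAle eq_sym n0 snorm_ge0.
rewrite -(ler_pM2r n0') -expr2 (sqr_snorm Phit) /dot approx_star.
have H1 := approxP k (h k); have H2 := rtrace_le e_proj ft (h k).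
have H3 := le_snorm (h k) fPhi; have H4 := rate_le1 (R := R) k.
have H5 := snorm_ge0 e f e.
have H6 : rate k * sn Phi (h k) <= 1 * sn Phi (h k) by rewrite ler_pM2r.
have H7 : sn f e * sn f (h k) <= sn f e * sn Phi (h k) by rewrite ler_wpM2l.
have H8 := ler_norm (Phi (h k ⋆ h k) - f (h k)).
have H9 := ler_norm (f (h k)); lra.
Qed.

Lemma approx_cauchy k l : sn Phi (h k - h l) <= rate k + rate l.
Proof.
have [->|n0] := eqVneq (sn Phi (h k - h l)) 0; first by rewrite addr_ge0 ?rate_ge0.
set d := h k - h l in n0 *.
have n0' : 0 < sn Phi d by rewrite lt_neqAle eq_sym n0 snorm_ge0.
rewrite -(ler_pM2r n0') -expr2 (sqr_snorm Phit) /dot {1}/d starB !approx_star.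
rewrite emulBl (rtraceB Phit).
have H1 := approxP k d; have H2 := approxP l d; rewrite distrC in H2.
have := ler_norm (Phi (h k ⋆ d) - f d); have := ler_norm (f d - Phi (h l ⋆ d)).
lra.
Qed.

(** For d = h b - b h, the squared seminorm of d is Phi(h (d b* - b* d)). This is close to the value
    of [f] at a commutator, which is 0. *)
Lemma approx_central b : exists K : R, 0 <= K /\
  forall k, sn Phi (h k ⋆ b - b ⋆ h k) <= rate k * K.
Proof.
have [K [K0 HK]] := emul_bounded (star b).
exists (K + K); split; first exact: addr_ge0.
move=> k; set d := _ - _.
have [->|n0] := eqVneq (sn Phi d) 0; first by rewrite mulr_ge0 ?rate_ge0 ?addr_ge0.
have n0' : 0 < sn Phi d by rewrite lt_neqAle eq_sym n0 snorm_ge0.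
rewrite -(ler_pM2r n0') -expr2 (sqr_snorm Phit) /dot {1}/d.
rewrite starB !(star_emul e_proj) approx_star emulBl (rtraceB Phit).
rewrite -[X in X - _](_ : Phi (h k ⋆ (d ⋆ star b)) = _); last first.
  by rewrite emulA (rtraceC Phit) !emulA.
rewrite -emulA -(rtraceB Phit) -emulBr.
have H1 := approxP k (d ⋆ star b - star b ⋆ d).
have H2 := snormB e_proj Phit (d ⋆ star b) (star b ⋆ d).
have [H3 H4] := HK Phi Phit d.
have : f (d ⋆ star b - star b ⋆ d) = 0 by rewrite (rtraceB ft) (rtraceC ft) subrr.
move=> H5; rewrite H5 subr0 in H1.
apply: (le_trans (ler_norm _)); apply: (le_trans H1).
rewrite -mulrA ler_wpM2l ?rate_ge0//; lra.
Qed.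

(* In operator terms, with [T_f], [T_g] the Radon-Nikodym derivatives in the
   commutant of the regular representation on L^2(Phi), [G] is the functional
   given by the product [T_f T_g]. *)
Definition product_functional (g G : A -> R) :=
  forall k b, `|g (h k ⋆ b) - G b| <= rate k * sn Phi b.

(** The limit exists because [h] is Cauchy for [Phi], which dominates [g]. The algebraic laws of [g]
    pass to the limit; positivity remains a premise, to be proved separately where extremality is
    used. *)
Lemma product_functional_exists g : rtrace e g -> dominated g Phi ->
  exists G, product_functional g G /\
    ((forall x, 0 <= G (star x ⋆ x)) -> rtrace e G).
Proof.
move=> gt gPhi.
have lim b : exists l, forall k, `|g (h k ⋆ b) - l| <= rate k * sn Phi b.
  apply: cauchy_rate_limit => k l; rewrite -(rtraceB gt) -emulBl.
  rewrite (le_trans (rtrace_bound e_proj gt _ _))//.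
  rewrite ler_pM ?snorm_ge0 ?le_snorm//.
  by rewrite (le_trans (le_snorm _ gPhi))// approx_cauchy.
have [G GP] := choice lim; exists G; split; first by move=> k b; exact: GP.
have G_eq (u : nat -> R) (c d l : R) b :
    (forall k, `|u k - l| <= rate k * c) ->
    (forall k, `|g (h k ⋆ b) - u k| <= rate k * d) -> G b = l.
  move=> ul gu; apply: (@eq_of_rate _ _ _ (sn Phi b + d + c)) => k.
  rewrite !mulrDr; have := GP b k; have := ul k; have := gu k.
  have := ler_distD (g (h k ⋆ b)) (G b) l; rewrite (distrC (G b) (g _)).
  have := ler_distD (u k) (g (h k ⋆ b)) l; lra.
have G_eq0 b (u : nat -> R) (c l : R) :
    (forall k, `|u k - l| <= rate k * c) ->
    (forall k, g (h k ⋆ b) = u k) -> G b = l.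
  move=> ul gu; apply: (G_eq u c 0) => // k.
  by rewrite gu subrr normr0 mulr0.
move=> G0; split => //.
- move=> x y; apply: (G_eq0 _ (fun k => g (h k ⋆ x) + g (h k ⋆ y))
    (sn Phi x + sn Phi y)) => k; last by rewrite emulDr (rtraceD gt).
  rewrite mulrDr (le_trans _ (lerD (GP x k) (GP y k)))//.
  by rewrite (le_trans _ (ler_normD _ _))// opprD addrACA.
- move=> r x; apply: (G_eq0 _ (fun k => r * g (h k ⋆ x)) (`|r| * sn Phi x)) => k.
    by rewrite -mulrBr normrM mulrCA ler_wpM2l.
  by rewrite emulZr (rtraceZ gt).
- move=> x; apply: (G_eq0 _ (fun k => g (h k ⋆ x)) (sn Phi x)) => // k.
  rewrite -(rtraceE gt) -[RHS](rtraceE gt) /emul !cmulA.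
  by rewrite -!(cmulA _ e e) !e_proj.2.
- move=> x; apply: (G_eq0 _ (fun k => g (h k ⋆ x)) (sn Phi x)) => // k.
  rewrite -(rtrace_star gt) (star_emul e_proj) starK approx_star.
  exact: (rtraceC gt).
(* By traciality of [g], the values for [x ⋆ y] and [y ⋆ x] differ only by a commutator of [h k]
   with [x]. *)
- move=> x y; have [K [K0 HK]] := approx_central x.
  apply: (G_eq (fun k => g (h k ⋆ (y ⋆ x))) (sn Phi (y ⋆ x)) (K * sn Phi y)) => // k.
  have -> : g (h k ⋆ (y ⋆ x)) = g (x ⋆ h k ⋆ y).
    by rewrite emulA (rtraceC gt) emulA.
  rewrite emulA -(rtraceB gt) -emulBl.
  rewrite (le_trans (rtrace_bound e_proj gt _ _))// mulrA.
  rewrite ler_pM ?snorm_ge0 ?le_snorm//.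
  by rewrite (le_trans (le_snorm _ gPhi)).
Qed.

(** The square equals [Phi (h k ⋆ (star b ⋆ (b ⋆ h k)))], to which the approximation property
    applies. Both terms tend to <T_f^2 b, b>. *)
Lemma sqr_snorm_approx b : exists K : R, 0 <= K /\ forall k,
  `|sn Phi (b ⋆ h k) ^+ 2 - f (h k ⋆ (star b ⋆ b))| <= rate k * K.
Proof.
have [K [K0 HK]] := emul_bounded b; have [L [L0 HL]] := emul_bounded (star b).
have M0 : 0 <= sn f e + 1 by rewrite addr_ge0 ?snorm_ge0.
exists (L * (K * (sn f e + 1))); split; first by rewrite !mulr_ge0.
move=> k; rewrite (sqr_snorm Phit) /dot (star_emul e_proj) approx_star -emulA.
have -> : f (h k ⋆ (star b ⋆ b)) = f (star b ⋆ (b ⋆ h k)).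
  by rewrite (rtraceC ft) emulA.
rewrite (le_trans (approxP k _))// ler_wpM2l ?rate_ge0//.
have [H1 _] := HL Phi Phit (b ⋆ h k); have [H2 _] := HK Phi Phit (h k).
rewrite (le_trans H1)// ler_wpM2l// (le_trans H2)// ler_wpM2l//.
exact: approx_bounded.
Qed.

(** Extremality in terms of order: [f] spans an extreme ray of the cone of traces. *)
Definition rextreme := forall G, rtrace e G ->
  (forall x, G (star x ⋆ x) <= f (star x ⋆ x)) ->
  exists c, forall x, G x = c * f x.

(** [G] is the functional of T_f^2, and 0 <= T_f^2 <= T_f because [Phi] dominates [f], so
    extremality makes it a multiple of [f]. If the factor were 0, the vector that represents [f]
    would vanish, against [f e = 1]. *)
Lemma extreme_idempotent : rextreme -> f e = 1 ->
  exists c, 0 < c /\ product_functional f (fun b => c * f b).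
Proof.
move=> fext f1; have [G [GP Gt]] := product_functional_exists ft fPhi.
have est b : 0 <= G (star b ⋆ b) <= f (star b ⋆ b).
  have [K [K0 HK]] := sqr_snorm_approx b.
  apply/andP; split; apply: (@le_of_rate _ _ _ (K + sn Phi (star b ⋆ b))) => k;
    rewrite mulrDr; have := GP k (star b ⋆ b); have := HK k;
    rewrite !ler_distl => /andP[H1 H2] /andP[H3 H4].
    have := sqr_ge0 (sn Phi (b ⋆ h k)); lra.
  have := le_trans (ler_norm _) (dot_CauchySchwarz e_proj ft b (b ⋆ h k)).
  have H5 := le_snorm (b ⋆ h k) fPhi; have := sqr_snorm ft b.
  have -> : dot e f b (b ⋆ h k) = f (h k ⋆ (star b ⋆ b)).
    by rewrite /dot emulA (rtraceC ft).
  have -> : dot e f b b = f (star b ⋆ b) by [].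
  have H6 := snorm_ge0 e f b.
  have H7 : sn f b * sn f (b ⋆ h k) <= sn f b * sn Phi (b ⋆ h k) by rewrite ler_wpM2l.
  have : 0 <= (sn f b - sn Phi (b ⋆ h k)) ^+ 2 by exact: sqr_ge0.
  nra.
have {Gt} Gt : rtrace e G by apply: Gt => x; case/andP: (est x).
have [|c Gc] := fext _ Gt; first by move=> x; case/andP: (est x).
have cP : product_functional f (fun b => c * f b) by move=> k b; rewrite -Gc.
exists c; split => //.
have ee : e ⋆ e = e by rewrite /emul !e_proj.2.
have c0 : 0 <= c.
  by have /andP[+ _] := est e; rewrite Gc star_base// ee f1 mulr1.
rewrite lt_neqAle c0 andbT eq_sym; apply/eqP => c0'.
suff : (2^-1 : R) <= 0 by rewrite leNgt invr_gt0 ltr0n.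
pose s := sn Phi e; pose M := sn f e + 1.
have s0 : 0 <= s by exact: snorm_ge0.
(* For x = [sn Phi (h k)], vanishing of [c] gives [x ^+ 2 <= rate k * (s + M)], whereas [f e = 1]
   gives [1 - rate k * s <= s * x]. The two are combined through
   [2 * (s * x) <= 1 + (s * x) ^+ 2]. *)
apply: (@le_of_rate _ _ _ (s ^+ 2 * (s + M) / 2 + s)) => k; rewrite add0r.
have H1 := approxP k (h k); have H2 := approx_bounded k.
have H3 := cP k e; rewrite c0' mul0r subr0 (rtraceC ft) (rtrace_mul1 e_proj ft) in H3.
have H4 := approxP k e; rewrite f1 in H4.
have H5 := rtrace_bound e_proj Phit (h k) e.
have H6 : sn Phi (h k) ^+ 2 = Phi (h k ⋆ h k).
  by rewrite (sqr_snorm Phit) /dot approx_star.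
rewrite -H6 in H1; move: H1 H3 H4 H5.
set x := sn Phi (h k) in H2 *; set r := rate k; rewrite -/s.
have r0 : 0 <= r by exact: rate_ge0.
rewrite ler_distl => /andP[_ H1]; rewrite ler_norml => /andP[_ H3].
rewrite ler_distl => /andP[H4 _]; rewrite ler_norml => /andP[_ H5].
have H7 : x ^+ 2 <= r * (s + M).
  by rewrite mulrDr; have : r * x <= r * M by [rewrite ler_wpM2l]; lra.
have H8 : s ^+ 2 * x ^+ 2 <= s ^+ 2 * (r * (s + M)) by rewrite ler_wpM2l ?sqr_ge0.
have : 0 <= (s * x - 1) ^+ 2 by exact: sqr_ge0.
nra.
Qed.

End Approx.

Section TwoTraces.
Context (f g : A -> R) (ft : rtrace e f) (gt : rtrace e g).
Context (fPhi : dominated f Phi) (gPhi : dominated g Phi).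
Context (h s : nat -> A) (fh : approx Phi f h) (gs : approx Phi g s).

(** Both values are limits of [Phi (s k ⋆ (h k ⋆ b))]: traciality moves [s k] around, and each of
    [h k], [s k] can be traded for its functional. *)
Lemma product_functional_comm G G' :
  product_functional h g G -> product_functional s f G' -> forall b, G b = G' b.
Proof.
move=> GP GP' b; have [K [K0 HK]] := emul_bounded b.
have f0 := snorm_ge0 e f e; have g0 := snorm_ge0 e g e.
apply: (@eq_of_rate _ _ _
  (sn Phi b + sn Phi b + K * (sn f e + 1) + K * (sn g e + 1))) => k.
have H1 := GP k b; have H2 := GP' k b.
have H3 := approxP gs k (h k ⋆ b); have H4 := approxP fh k (b ⋆ s k).
have E1 : Phi (h k ⋆ (b ⋆ s k)) = Phi (s k ⋆ (h k ⋆ b)).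
  by rewrite emulA (rtraceC Phit).
have E2 : f (b ⋆ s k) = f (s k ⋆ b) by exact: (rtraceC ft).
rewrite E1 E2 in H4.
have r0 := rate_ge0 (R := R) k.
have H5 : rate k * sn Phi (h k ⋆ b) <= rate k * (K * (sn f e + 1)).
  rewrite ler_wpM2l// (le_trans (HK _ Phit (h k)).2)// ler_wpM2l//.
  exact: (approx_bounded ft).
have H6 : rate k * sn Phi (b ⋆ s k) <= rate k * (K * (sn g e + 1)).
  rewrite ler_wpM2l// (le_trans (HK _ Phit (s k)).1)// ler_wpM2l//.
  exact: (approx_bounded gt).
rewrite ler_distl; move: H1 H2 H3 H4; rewrite !ler_distl.
move=> /andP[? ?] /andP[? ?] /andP[? ?] /andP[? ?].
by apply/andP; split; lra.
Qed.

(* [T_f^2 = c T_f] gives [T_f T_g T_f = c T_f T_g]. *)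
Lemma compressed_product c G b : 0 <= c ->
  product_functional h f (fun x => c * f x) ->
  product_functional h g G ->
  exists K, forall k eps, 0 < eps -> exists l, (k <= l)%N /\
    `|g (b ⋆ (h k ⋆ h l)) - c * G b| <= rate k * K + eps.
Proof.
move=> c0 cP GP; have [G' [GP' _]] := product_functional_exists gt gs ft fPhi.
have GG' := product_functional_comm GP GP' b.
have [K [K0 HK]] := emul_bounded b.
exists (K * (sn g e + 1)) => k eps eps0.
have [L [L0 HL]] := emul_bounded (h k).
have f0 := snorm_ge0 e f e; have g0 := snorm_ge0 e g e.
have eps1 : 0 < eps / 3 by rewrite divr_gt0.
(* The index [m] is chosen uniformly in [l], and [l] afterwards. The chain is g(b h_k h_l), Phi(s_m
   b h_k h_l), f(s_m b h_k), c f(s_m b), c G(b); its third link costs [rate k * K] and the others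
   [eps / 3] each. *)
have [m [_ Hm1 Hm2]] :=
  rate_small2 (K * (L * (sn f e + 1))) (c * sn Phi b) 0 eps1.
have [l [kl Hl _]] := rate_small2 (sn Phi (s m ⋆ (b ⋆ h k))) 0 k eps1.
exists l; split=> //.
have H1 := approxP gs m (b ⋆ (h k ⋆ h l)).
have H1' : rate m * sn Phi (b ⋆ (h k ⋆ h l)) <= eps / 3.
  rewrite (le_trans _ Hm1)// ler_wpM2l ?rate_ge0//.
  rewrite (le_trans (HK _ Phit _).1)// ler_wpM2l//.
  rewrite (le_trans (HL _ Phit _).1)// ler_wpM2l//.
  exact: (approx_bounded ft).
have H2 := approxP fh l (s m ⋆ (b ⋆ h k)).
have E2 : Phi (h l ⋆ (s m ⋆ (b ⋆ h k))) = Phi (s m ⋆ (b ⋆ (h k ⋆ h l))).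
  by rewrite (rtraceC Phit) -!emulA.
have H3 := cP k (s m ⋆ b).
have E3 : f (h k ⋆ (s m ⋆ b)) = f (s m ⋆ (b ⋆ h k)).
  by rewrite (rtraceC ft) -!emulA.
have H3' : rate k * sn Phi (s m ⋆ b) <= rate k * (K * (sn g e + 1)).
  rewrite ler_wpM2l ?rate_ge0// (le_trans (HK _ Phit _).2)// ler_wpM2l//.
  exact: (approx_bounded gt).
have H4 : c * `|f (s m ⋆ b) - G b| <= c * (rate m * sn Phi b).
  by rewrite ler_wpM2l// GG'; exact: GP'.
rewrite -{1}(ger0_norm c0) -normrM mulrBr in H4.
rewrite E2 in H2; rewrite E3 in H3.
rewrite ler_distl; move: H1 H2 H3 H4; rewrite !ler_distl.
move=> /andP[? ?] /andP[? ?] /andP[? ?] /andP[? ?].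
by apply/andP; split; lra.
Qed.

(** Up to small errors, c G(b* b) is the [g]-inner product of [b ⋆ h l] and [b ⋆ h k]. This is
    almost a square, and by Cauchy-Schwarz it is at most about c f(b* b). Hence 0 <= c T_f T_g <= c
    T_f, and extremality applies after division by [c]. *)
Lemma product_extreme : rextreme f -> f e = 1 ->
  exists d, product_functional h g (fun x => d * f x).
Proof.
move=> fext f1.
have [c [c0 cP]] := extreme_idempotent ft fPhi fh fext f1.
have [G [GP Gt]] := product_functional_exists ft fh gt gPhi.
have est b : 0 <= c * G (star b ⋆ b) <= c * f (star b ⋆ b).
  have [K HK] := compressed_product (star b ⋆ b) (ltW c0) cP GP.
  have [L [L0 HL]] := sqr_snorm_approx ft fPhi fh b.
  have [N [N0 HN]] := emul_bounded b.
  have r0 := rate_ge0 (R := R).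
  pose P := L + sn Phi (star b ⋆ b).
  have bound k : sn Phi (b ⋆ h k) ^+ 2 <= c * f (star b ⋆ b) + rate k * P.
    have := HL k; have := cP k (star b ⋆ b); rewrite !ler_distl mulrDr.
    by move=> /andP[? ?] /andP[? ?]; lra.
  (* [rate k * D] bounds the error of replacing [h l] by [h k] in the inner product, as [l >= k]. *)
  pose D := N * (sn f e + 1) * (N * 2).
  suff key k : - (rate k * (K + D + 1)) <= c * G (star b ⋆ b) <=
      c * f (star b ⋆ b) + rate k * (K + `|P| + 1).
    apply/andP; split; [apply: (@le_of_rate _ _ _ (K + D + 1)) |
      apply: (@le_of_rate _ _ _ (K + `|P| + 1))] => k;
      have /andP[? ?] := key k; lra.
  have [l [kl Hl]] := HK k _ (rate_gt0 k).
  have E : g (star b ⋆ b ⋆ (h k ⋆ h l)) = dot e g (b ⋆ h l) (b ⋆ h k).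
    rewrite /dot (star_emul e_proj) (approx_star fh) (rtraceC gt).
    by rewrite (rtraceC gt) !emulA (rtraceC gt) !emulA.
  rewrite E ler_distl in Hl; case/andP: Hl => Hl1 Hl2.
  have rl : rate l <= rate k :> R by exact: le_rate.
  apply/andP; split.
    have H1 : - (rate k * D) <= dot e g (b ⋆ h l) (b ⋆ h k); last by lra.
    have -> : dot e g (b ⋆ h l) (b ⋆ h k) =
        dot e g (b ⋆ h k) (b ⋆ h k) + dot e g (b ⋆ (h l - h k)) (b ⋆ h k).
      by rewrite -(dotDl e_proj gt) -emulDr addrC subrK.
    have H2 := dot_ge0 gt (b ⋆ h k).
    have := dot_CauchySchwarz e_proj gt (b ⋆ (h l - h k)) (b ⋆ h k).
    have : sn g (b ⋆ (h l - h k)) * sn g (b ⋆ h k) <= rate k * D.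
      have -> : rate k * D = (N * (rate k + rate k)) * (N * (sn f e + 1)).
        by rewrite /D; ring.
      rewrite ler_pM ?snorm_ge0//.
        rewrite (le_trans (HN _ gt _).1)// ler_wpM2l// (le_trans (le_snorm _ gPhi))//.
        by rewrite (le_trans (approx_cauchy fh _ _))// lerD2r.
      rewrite (le_trans (HN _ gt _).1)// ler_wpM2l// (le_trans (le_snorm _ gPhi))//.
      exact: (approx_bounded ft).
    by rewrite ler_norml => ? /andP[? ?]; lra.
  have H1 : dot e g (b ⋆ h l) (b ⋆ h k) <= c * f (star b ⋆ b) + rate k * `|P|;
    last by lra.
  have H2 := le_trans (ler_norm _)
    (dot_CauchySchwarz e_proj gt (b ⋆ h l) (b ⋆ h k)).
  apply: (le_trans H2).
  have H3 : sn g (b ⋆ h l) * sn g (b ⋆ h k) <= sn Phi (b ⋆ h l) * sn Phi (b ⋆ h k).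
    by rewrite ler_pM ?snorm_ge0 ?le_snorm.
  have : 0 <= (sn Phi (b ⋆ h l) - sn Phi (b ⋆ h k)) ^+ 2 by exact: sqr_ge0.
  have := bound k; have := bound l.
  have : rate l * P <= rate k * `|P|.
    rewrite (le_trans (ler_wpM2l (r0 l) (ler_norm P)))//.
    by rewrite ler_wpM2r.
  have : rate k * P <= rate k * `|P| by rewrite ler_wpM2l// ler_norm.
  nra.
have {Gt} Gt : rtrace e G.
  by apply: Gt => b; case/andP: (est b); rewrite pmulr_rge0.
have [|d Gd] := fext _ Gt.
  by move=> b; have /andP[_] := est b; rewrite ler_pM2l.
by exists d => k b; rewrite -Gd.
Qed.

End TwoTraces.

(** The product is both [d] times [f] and [d'] times [g]. Evaluation at [e] gives [d = d'], so a
    nonzero [d] would force [f = g]. *)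
Lemma extreme_orthogonal f g h : rtrace e f -> rtrace e g ->
  dominated f Phi -> dominated g Phi -> approx Phi f h ->
  rextreme f -> rextreme g -> f e = 1 -> g e = 1 -> f <> g ->
  product_functional h g (fun=> 0).
Proof.
move=> ft gt fPhi gPhi fh fext gext f1 g1 fg.
have [s gs] := approx_exists gt gPhi.
have [d dP] := product_extreme ft gt fPhi gPhi fh gs fext f1.
have [d' d'P] := product_extreme gt ft gPhi fPhi gs fh gext g1.
have dd' := product_functional_comm ft gt fPhi gPhi fh gs dP d'P.
have edd' : d = d' by have := dd' e; rewrite f1 g1 !mulr1.
have d0 : d = 0.
  apply: contra_notP fg => /eqP d0; apply: funext => b.
  by apply: (mulfI d0); rewrite dd' edd'.
by move=> k b; have := dP k b; rewrite d0 mul0r.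
Qed.

End RadonNikodym.

Section Independence.
Context {R : realType} {A : cstarAlgType R} (e : A) (e_proj : projections e).

Lemma rtrace_sum n (f : 'I_n -> A -> R) :
  (forall i, rtrace e (f i)) -> rtrace e (fun a => \sum_i f i a).
Proof.
move=> ft; split.
- by move=> x y; rewrite -big_split; apply: eq_bigr => i _; exact: (rtraceD (ft i)).
- by move=> r x; rewrite mulr_sumr; apply: eq_bigr => i _; exact: (rtraceZ (ft i)).
- by move=> x; apply: eq_bigr => i _; exact: (rtraceE (ft i)).
- by move=> x; apply: eq_bigr => i _; exact: (rtrace_star (ft i)).
- by move=> x y; apply: eq_bigr => i _; exact: (rtraceC (ft i)).
- by move=> x; apply: sumr_ge0 => i _; exact: (rtrace_ge0 (ft i)).
Qed.

(** Evaluating the relation at [emul e (h k) e] amounts to applying T_i. By orthogonality only the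
    [i]-th term survives in the limit, and it is [lam i * c] with [c > 0]. *)
Lemma extreme_independent n (f : 'I_n -> A -> R) (lam : 'I_n -> R) :
  (forall i, rtrace e (f i)) -> (forall i, rextreme e (f i)) ->
  (forall i, f i e = 1) -> injective f ->
  (forall b, \sum_i lam i * f i b = 0) -> forall i, lam i = 0.
Proof.
move=> ft fext f1 finj lam0 i.
have Phit := rtrace_sum ft; set Phi := (fun _ => _) in Phit.
have fPhi j : dominated e (f j) Phi.
  move=> x; rewrite /dot /Phi (bigD1 j)//= lerDl sumr_ge0// => k _.
  exact: rtrace_ge0 (ft k) x.
have [h fh] := approx_exists e_proj Phit (ft i) (fPhi i).
have [c [c0 cP]] := extreme_idempotent e_proj Phit (ft i) (fPhi i)
  fh (fext i) (f1 i).
suff : lam i * c = 0 by move=> /eqP; rewrite mulf_eq0 (gt_eqF c0) orbF => /eqP.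
apply: (@eq_of_rate _ _ _ (\sum_j `|lam j| * snorm e Phi e)) => k.
rewrite subr0 -[c]mulr1 -(f1 i).
pose G j b := if j == i then c * f i b else 0.
have -> : lam i * (c * f i e) = \sum_j lam j * G j e.
  rewrite (bigD1 i)//= /G eqxx big1 ?addr0// => j ji.
  by rewrite (negbTE ji) mulr0.
have -> : \sum_j lam j * G j e =
    \sum_j (lam j * G j e - lam j * f j (emul e (h k) e)).
  by rewrite sumrB lam0 subr0.
rewrite (le_trans (ler_norm_sum _ _ _))// mulr_sumr ler_sum// => j _.
rewrite -mulrBr normrM mulrCA ler_wpM2l// distrC /G.
case: (eqVneq j i) => [->|ji]; first exact: cP.
apply: (extreme_orthogonal e_proj Phit (ft i) (ft j) (fPhi i)
  (fPhi j) fh) => //; try exact: fext; try exact: ft.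
by move=> fij; move: ji; rewrite (finj _ _ fij) eqxx.
Qed.

End Independence.

(** * Tracial states *)

Section States.
Context {R : realType} {A : cstarAlgType R} (e : A) (e_proj : projections e).
Implicit Types (phi : functionals A) (f : A -> R).

Lemma compress_corner x : corner e (e ** x ** e).
Proof. by rewrite /corner /= !cmulA e_proj.2 -!cmulA e_proj.2. Qed.

Lemma compressM x y : (e ** x ** e) ** (e ** y ** e) = e ** (x ** e ** y) ** e.
Proof. by rewrite !cmulA -(cmulA (e ** x) e e) e_proj.2. Qed.

Lemma compress_star x : star (e ** x ** e) = e ** star x ** e.
Proof. by rewrite !starM e_proj.1 cmulA. Qed.

Section OneState.
Context phi (phiT : tracial_states e phi).

Lemma stateP (c : R[i]) x y : phi (c *: x + y) = c * phi x + phi y.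
Proof. by have [H _ _ _ _] := phiT; exact: H. Qed.

Lemma state0 : phi 0 = 0.
Proof.
have := stateP 1 0 0; rewrite scale1r addr0 mul1r => H.
by apply: (@addrI _ (phi 0)); rewrite -H addr0.
Qed.

Lemma stateD x y : phi (x + y) = phi x + phi y.
Proof. by have := stateP 1 x y; rewrite scale1r mul1r. Qed.

Lemma stateZ (c : R[i]) x : phi (c *: x) = c * phi x.
Proof. by have := stateP c x 0; rewrite !addr0 state0 addr0. Qed.

Lemma stateB x y : phi (x - y) = phi x - phi y.
Proof. by apply: (@addIr _ (phi y)); rewrite -stateD !subrK. Qed.

Lemma stateE x : phi (e ** x ** e) = phi x.
Proof. by have [_ H _ _ _] := phiT. Qed.

Lemma state1 : phi e = 1.
Proof. by have [_ _ _ H _] := phiT. Qed.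

Lemma stateC x y : phi (x ** e ** y) = phi (y ** e ** x).
Proof.
have [_ _ _ _ H] := phiT.
by have := H _ _ (compress_corner x) (compress_corner y); rewrite !compressM !stateE.
Qed.

Lemma state_ge0 x : 0 <= (phi (star x ** e ** x) : R[i]).
Proof.
have [_ _ H _ _] := phiT; have := H _ (compress_corner x).
by rewrite compress_star compressM stateE.
Qed.

(** Polarization: positivity makes phi(z* e z) real, and the cases z = x + e and z = x + ie compare
    the imaginary and the real parts. *)
Lemma state_star x : phi (star x) = Num.conj (phi x : R[i]).
Proof.
have im0 z : complex.Im (phi (star z ** e ** z) : R[i]) = 0.
  exact: ger0_Im (state_ge0 z).
have xe y : phi (y ** e ** e) = phi y.
  rewrite -[RHS]stateE -stateE !cmulA -!(cmulA _ e e) e_proj.2.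
  by rewrite -!cmulA e_proj.2.
have ex y : phi (e ** e ** y) = phi y by rewrite -stateC xe.
have H1 := im0 (x + e).
have H2 := im0 (x + 'i *: e).
rewrite starD e_proj.1 !cmulDl !cmulDr !stateD xe ex in H1.
rewrite starD starZ e_proj.1 !cmulDl !cmulDr !cmulZl !cmulZr !stateD in H2.
rewrite !stateZ xe ex in H2.
have H3 := im0 x; have H4 := im0 e; rewrite e_proj.1 in H4.
move: H1 H2 H3 H4.
case: (phi (star x ** e ** x)) => a1 a2; case: (phi (e ** e ** e)) => b1 b2.
case: (phi (star x)) => c1 c2; case: (phi x) => d1 d2 /= H1 H2 H3 H4.
by apply/eqP; rewrite eq_complex /=; apply/andP; split; apply/eqP; lra.
Qed.

Definition re_state (a : A) : R := complex.Re (phi a : R[i]).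

Lemma re_state_rtrace : rtrace e re_state.
Proof.
split.
- by move=> x y; rewrite /re_state stateD; case: (phi x) (phi y) => ? ? [].
- by move=> r x; rewrite /re_state stateZ; case: (phi x) => a b /=; ring.
- by move=> x; rewrite /re_state stateE.
- by move=> x; rewrite /re_state state_star; case: (phi x).
- by move=> x y; rewrite /re_state /emul stateC.
- by move=> x; have := state_ge0 x; rewrite lecE => /andP[].
Qed.

Lemma re_state1 : re_state e = 1.
Proof. by rewrite /re_state state1. Qed.

Lemma im_state a : complex.Im (phi a : R[i]) = - re_state ('i *: a).
Proof. by rewrite /re_state stateZ; case: (phi a) => a1 a2 /=; ring. Qed.

(** The real and the imaginary part contribute a factor 2 each, from [rtrace_nrm]. *)
Lemma state_nrm a : complex.Re `|phi a : R[i]| <= 4 * nrm a.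
Proof.
have H1 := rtrace_nrm e_proj a re_state_rtrace.
have H2 := rtrace_nrm e_proj ('i *: a) re_state_rtrace.
have i1 : nrm ('i *: a) = nrm a.
  rewrite nrmZ normc_def /= expr0n expr1n add0r sqrtr1 mul1r //.
rewrite re_state1 in H1; rewrite re_state1 i1 -normrN -im_state in H2.
have : complex.Re `|phi a : R[i]| <= `|complex.Re (phi a : R[i])| + `|complex.Im (phi a : R[i])|.
  rewrite normc_def /= -(@ler_pXn2r _ 2) ?nnegrE ?addr_ge0 ?sqrtr_ge0//.
  rewrite sqr_sqrtr ?addr_ge0 ?sqr_ge0// sqrrD !real_normK ?num_real//.
  by rewrite -addrA lerD2l lerDr mulrn_wge0// mulr_ge0.
by rewrite /re_state in H1; lra.
Qed.

End OneState.

(** For a real-linear [f], this is the complex-linear functional with real part [f]. *)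
Definition cplx_state (f : A -> R) : functionals A :=
  fun a => f a +i* (- f ('i *: a)).

Lemma cplx_stateP f : rtrace e f -> f e = 1 -> tracial_states e (cplx_state f).
Proof.
move=> ft f1.
have fi0 x : star x = x -> f ('i *: x) = 0.
  move=> xs; have := rtrace_star ft ('i *: x).
  rewrite starZ xs (_ : Num.conj ('i : R[i]) = - 'i); last first.
    by apply/eqP; rewrite eq_complex /= oppr0 !eqxx.
  by rewrite scaleNr (rtraceN ft) => /eqP; rewrite eqNr => /eqP.
have corner_emul x y : corner e x -> corner e y -> x ** y = emul e x y.
  by move=> /(corner_mul e_proj)[_ xe] _; rewrite /emul xe.
split.
- move=> c x y; rewrite /cplx_state scalerDr !(rtraceD ft) scalerA.
  have key (z : R[i]) u : f (z *: u) = complex.Re z * f u + complex.Im z * f ('i *: u).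
    rewrite -(rtraceZ ft) -(rtraceZ ft) -(rtraceD ft); congr f.
    rewrite scalerA -scalerDl; congr (_ *: _).
    by rewrite {1}(complexE z) (mulrC 'i).
  rewrite (key c) (key ('i * c)); case: c => a b.
  by apply/eqP; rewrite eq_complex /=; apply/andP; split; apply/eqP; ring.
- move=> a; rewrite /cplx_state (rtraceE ft); congr (_ +i* - _).
  by rewrite -[RHS](rtraceE ft) cmulZr cmulZl.
- move=> x xe; rewrite /cplx_state lecE /= fi0 ?oppr0 ?eqxx/=.
    by rewrite -[x in _ ** x](corner_mul e_proj xe).1 cmulA (rtrace_ge0 ft).
  by rewrite starM starK.
- by rewrite /cplx_state f1 fi0 ?e_proj.1// oppr0.
- move=> x y xe ye; rewrite /cplx_state !corner_emul// (rtraceC ft x y).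
  by congr (_ +i* - _); rewrite -emulZl (rtraceC ft) emulZr.
Qed.

Lemma re_cplx_state f : re_state (cplx_state f) = f.
Proof. by []. Qed.

Lemma rtrace_lin f g (r s : R) : rtrace e f -> rtrace e g ->
  (forall x, 0 <= r * f (emul e (star x) x) + s * g (emul e (star x) x)) ->
  rtrace e (fun a => r * f a + s * g a).
Proof.
move=> ft gt pos; split => //.
- by move=> x y; rewrite (rtraceD ft) (rtraceD gt); ring.
- by move=> t x; rewrite (rtraceZ ft) (rtraceZ gt); ring.
- by move=> x; rewrite (rtraceE ft) (rtraceE gt).
- by move=> x; rewrite (rtrace_star ft) (rtrace_star gt).
- by move=> x y; rewrite (rtraceC ft) (rtraceC gt).
Qed.

(** For c = G(e) > 0, f is the convex combination of G/c with weight c/2 and of the normalization of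
    f - G/2. Halving [G] keeps the weight strictly below 1 even if c = 1. If c = 0, then [G]
    vanishes by Cauchy-Schwarz. *)
Lemma re_state_extreme phi :
  extreme_points (tracial_states e) phi -> rextreme e (re_state phi).
Proof.
move=> [phiT ext] G Gt Gf; exists (G e).
have ft := re_state_rtrace phiT; set f := re_state phi in ft Gf *.
have f1 : f e = 1 by exact: re_state1.
have see : emul e (star e) e = e by rewrite /emul e_proj.1 !e_proj.2.
have c0 : 0 <= G e by have := rtrace_ge0 Gt e; rewrite see.
have c1 : G e <= 1 by have := Gf e; rewrite see f1.
have [G0|G0] := eqVneq (G e) 0.
  move=> x; rewrite G0 mul0r; apply/eqP; rewrite -normr_le0.
  have := rtrace_le e_proj Gt x.
  by rewrite /snorm /dot see G0 sqrtr0 mul0r.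
set c := G e in c0 c1 G0 *.
have cpos : 0 < c by rewrite lt_neqAle eq_sym G0.
have t1 := rtrace_lin (r := c^-1) (s := 0) Gt ft.
have t2 := rtrace_lin (r := (1 - c / 2)^-1) (s := - (1 - c / 2)^-1 / 2) ft Gt.
have d0 : 0 < 1 - c / 2 by lra.
set psi1 := fun _ => _ in t1; set psi2 := fun _ => _ in t2.
have T1 : tracial_states e (cplx_state psi1).
  apply: cplx_stateP; last by rewrite /psi1 -/c mul0r addr0 mulVf.
  by apply: t1 => x; rewrite mul0r addr0 mulr_ge0 ?invr_ge0 ?(rtrace_ge0 Gt).
have T2 : tracial_states e (cplx_state psi2).
  apply: cplx_stateP; last by rewrite /psi2 f1 -/c; field; rewrite gt_eqF//; lra.
  apply: t2 => x; have -> : - (1 - c / 2)^-1 / 2 * G (emul e (star x) x) =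
    (1 - c / 2)^-1 * (- (G (emul e (star x) x) / 2)) by ring.
  rewrite -mulrDr mulr_ge0 ?invr_ge0 ?(ltW d0)//.
  by have := Gf x; have := rtrace_ge0 Gt x; lra.
have [||E _] := ext _ _ (c / 2) T1 T2; first by apply/andP; split; lra.
  apply: funext => a; rewrite /convex_comb /cplx_state.
  have fe b : f b = c / 2 * psi1 b + (1 - c / 2) * psi2 b.
    by rewrite /psi1 /psi2; field; rewrite G0 gt_eqF//; lra.
  rewrite [LHS](_ : _ = f a +i* - f ('i *: a)); last first.
    rewrite /f -im_state// /re_state; by case: (phi a).
  by rewrite !fe; apply/eqP; rewrite eq_complex /=; apply/andP; split;
    apply/eqP; ring.
move=> x; have := congr1 (fun u => re_state u x) E.
rewrite re_cplx_state /psi1 -/f mul0r addr0 => <-.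
by rewrite mulVKf.
Qed.

End States.

(** * Traces on the ideal AeA *)

Section Ideal.
Context {R : realType} {A : cstarAlgType R} (e : A) (e_proj : projections e).
Implicit Types (phi : functionals A) (s t : seq (A * A)).

Lemma cmul_suml (I : Type) (r : seq I) (F : I -> A) x :
  (\sum_(i <- r) F i) ** x = \sum_(i <- r) F i ** x.
Proof.
exact: (big_morph (fun u => u ** x) (fun u v => cmulDl u v x) (cmul0l x)).
Qed.

Lemma cmul_sumr (I : Type) (r : seq I) (F : I -> A) x :
  x ** (\sum_(i <- r) F i) = \sum_(i <- r) x ** F i.
Proof. exact: (big_morph (cmul x) (cmulDr x) (cmul0r x)). Qed.

Lemma state_sum phi (I : Type) (r : seq I) (F : I -> A) : tracial_states e phi ->
  phi (\sum_(i <- r) F i) = \sum_(i <- r) phi (F i).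
Proof. by move=> phiT; exact: (big_morph phi (stateD phiT) (state0 phiT)). Qed.

(** A list of pairs (x, y) presents the element sum x e y of AeA. Traciality dictates phi(y x) as
    the value at x e y; it is defined on presentations first, and [ideal_trace_eq] shows that it
    depends only on the element. *)
Definition ideal_elt s : A := \sum_(p <- s) p.1 ** e ** p.2.
Definition ideal_trace phi s : R[i] := \sum_(p <- s) phi (p.2 ** p.1).
Definition base_ideal : set A := range ideal_elt.

Lemma ideal_elt_cat s t : ideal_elt (s ++ t) = ideal_elt s + ideal_elt t.
Proof. exact: big_cat. Qed.

Lemma ideal_elt_mul a b s :
  ideal_elt [seq (a ** p.1, p.2 ** b) | p <- s] = a ** ideal_elt s ** b.
Proof.
rewrite /ideal_elt big_map cmul_sumr cmul_suml; apply: eq_bigr => p _ /=.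
by rewrite !cmulA.
Qed.

Lemma ideal_elt_mull a s :
  ideal_elt [seq (a ** p.1, p.2) | p <- s] = a ** ideal_elt s.
Proof.
by rewrite /ideal_elt big_map cmul_sumr; apply: eq_bigr => p _ /=; rewrite !cmulA.
Qed.

Lemma ideal_elt_mulr b s :
  ideal_elt [seq (p.1, p.2 ** b) | p <- s] = ideal_elt s ** b.
Proof.
by rewrite /ideal_elt big_map cmul_suml; apply: eq_bigr => p _ /=; rewrite !cmulA.
Qed.

Lemma ideal_elt_scale (c : R[i]) s :
  ideal_elt [seq (c *: p.1, p.2) | p <- s] = c *: ideal_elt s.
Proof.
rewrite /ideal_elt big_map scaler_sumr; apply: eq_bigr => p _ /=.
by rewrite !cmulZl.
Qed.

Lemma ideal_trace_cat phi s t :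
  ideal_trace phi (s ++ t) = ideal_trace phi s + ideal_trace phi t.
Proof. exact: big_cat. Qed.

Lemma ideal_trace_scale phi (c : R[i]) s : tracial_states e phi ->
  ideal_trace phi [seq (c *: p.1, p.2) | p <- s] = c * ideal_trace phi s.
Proof.
move=> phiT; rewrite /ideal_trace big_map mulr_sumr; apply: eq_bigr => p _ /=.
by rewrite cmulZr (stateZ phiT).
Qed.

Lemma base_ideal_dense : is_simple A -> e != 0 -> closure base_ideal = setT.
Proof.
move=> [_ simple] e0.
have D x y : base_ideal x -> base_ideal y -> base_ideal (x + y).
  by move=> [s _ <-] [t _ <-]; exists (s ++ t); rewrite ?ideal_elt_cat.
have [||//] := simple (closure base_ideal); last first.
  move=> cl0; move: e0.
  suff : [set 0 : A] e by move=> ->; rewrite eqxx.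
  rewrite -cl0; apply: subset_closure; exists [:: (e, e)] => //.
  by rewrite /ideal_elt big_seq1 /= !e_proj.2.
split.
- by apply: subset_closure; exists [::] => //; rewrite /ideal_elt big_nil.
- move=> x y /closure_nrm Jx /closure_nrm Jy; apply/closure_nrm => r r0.
  have [x' Jx' xx'] := Jx _ (divr_gt0 r0 (ltr0n R 2)).
  have [y' Jy' yy'] := Jy _ (divr_gt0 r0 (ltr0n R 2)).
  exists (x' + y'); first exact: D.
  by have := nrmD (x - x') (y - y'); rewrite opprD addrACA; lra.
- move=> c x /closure_nrm Jx; apply/closure_nrm => r r0.
  pose k := complex.Re `|c|; have k0 : 0 <= k := re_norm_ge0 c.
  have k1 : 0 < k + 1 by lra.
  have [_ [s _ <-] xx'] := Jx _ (divr_gt0 r0 k1).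
  exists (c *: ideal_elt s).
    by exists [seq (c *: p.1, p.2) | p <- s]; rewrite ?ideal_elt_scale.
  rewrite -scalerBr nrmZ -/k.
  rewrite ltr_pdivlMr// in xx'; have := nrm_ge0 (x - ideal_elt s); nra.
- move=> a x /closure_nrm Jx; have k1 : 0 < nrm a + 1.
    by have := nrm_ge0 a; lra.
  split; apply/closure_nrm => r r0; have [_ [s _ <-] xx'] := Jx _ (divr_gt0 r0 k1).
    exists (a ** ideal_elt s).
      by exists [seq (a ** p.1, p.2) | p <- s]; rewrite ?ideal_elt_mull.
    rewrite -cmulBr (le_lt_trans (nrmM _ _))//; rewrite ltr_pdivlMr// in xx'.
    by have := nrm_ge0 (x - ideal_elt s); nra.
  exists (ideal_elt s ** a).
    by exists [seq (p.1, p.2 ** a) | p <- s]; rewrite ?ideal_elt_mulr.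
  rewrite -cmulBl (le_lt_trans (nrmM _ _))//; rewrite ltr_pdivlMr// in xx'.
  by have := nrm_ge0 (x - ideal_elt s); nra.
- exact: closed_closure.
Qed.

Context (ideal_dense : closure base_ideal = setT).

Lemma ideal_approx x (r : R) : 0 < r -> exists s, nrm (x - ideal_elt s) < r.
Proof.
move=> r0; have /closure_nrm/(_ r r0)[_ [s _ <-] H] : closure base_ideal x.
  by rewrite ideal_dense.
by exists s.
Qed.

(* If [z] in the ideal is close to [p] then [p z p] is invertible in [p A p]. *)
Lemma projection_ideal p : projections p -> base_ideal p.
Proof.
move=> pP; have half0 : 0 < (2^-1 : R) by rewrite invr_gt0.
have [s ps] := ideal_approx p half0; set z := ideal_elt s in ps.
have [_ pp] := pP; pose x := p - p ** z ** p.
have p1 := nrm_projection pP; have p0 := nrm_ge0 p.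
have xn : nrm x <= 2^-1.
  have -> : x = p ** (p - z) ** p by rewrite /x cmulBr cmulBl !pp.
  rewrite (le_trans (nrmM _ _))// (le_trans (ler_piMr (nrm_ge0 _) p1))//.
  by rewrite (le_trans (nrmM _ _))// (le_trans (ler_piMl (nrm_ge0 _) p1))// ltW.
have px : p ** x = x by rewrite /x cmulBr !cmulA !pp.
(* The fixed point satisfies [(p - x) ** w = p], where [p - x] is [p ** z ** p]. *)
have [|||w _ xw] := @contraction_fixpoint _ _ (fun w => p + x ** w) setT 0 I => //.
  move=> v w _ _; rewrite opprD addrACA subrr add0r -cmulBr.
  by rewrite (le_trans (nrmM _ _))// ler_wpM2r// nrm_ge0.
have pw : p ** w = w by rewrite -{1}xw cmulDr cmulA pp px.
exists [seq (p ** q.1, q.2 ** (p ** w)) | q <- s] => //.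
rewrite ideal_elt_mul cmulA.
have -> : p ** ideal_elt s ** p = p - x by rewrite /x opprB addrC subrK.
by rewrite cmulBl pw -{1}xw addrK.
Qed.

Lemma approx_unit_pairs s (u : nat -> A) (r : R) :
  (forall a, (fun n => u n ** a) @ \oo --> a) -> 0 < r ->
  exists N, forall n, (N <= n)%N ->
    \sum_(p <- s) nrm p.2 * nrm (p.1 - u n ** p.1) <= r.
Proof.
move=> ua; elim: s r => [|p s IH] r r0.
  by exists 0 => n _; rewrite big_nil ltW.
have [N1 H1] := IH _ (divr_gt0 r0 (ltr0n R 2)).
have k1 : 0 < nrm p.2 + 1 by have := nrm_ge0 p.2; lra.
have [N2 H2] := cvg_nrm (ua p.1) (divr_gt0 (divr_gt0 r0 (ltr0n R 2)) k1).
exists (maxn N1 N2) => n; rewrite geq_max => /andP[/H1 n1 /H2 n2].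
rewrite big_cons; rewrite ltr_pdivlMr// nrm_distC in n2.
by have := nrm_ge0 (p.1 - u n ** p.1); nra.
Qed.

(* [y v x] with [v] in the ideal is cyclically a multiple of [sum x e y]. *)
Lemma ideal_trace_sandwich phi s t : tracial_states e phi -> ideal_elt s = 0 ->
  \sum_(p <- s) phi (p.2 ** ideal_elt t ** p.1) = 0.
Proof.
move=> phiT s0.
under eq_bigr do rewrite /ideal_elt cmul_sumr cmul_suml (state_sum _ _ phiT).
rewrite exchange_big big1_seq//= => q _.
transitivity (phi (q.2 ** ideal_elt s ** q.1)); last first.
  by rewrite s0 cmul0r cmul0l (state0 phiT).
rewrite /ideal_elt cmul_sumr cmul_suml (state_sum _ _ phiT).
apply: eq_bigr => p _.
have -> : p.2 ** (q.1 ** e ** q.2) ** p.1 = (p.2 ** q.1) ** e ** (q.2 ** p.1).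
  by rewrite !cmulA.
by rewrite (stateC e_proj phiT) !cmulA.
Qed.

(** An element of the ideal close to an approximate unit is inserted between [p.2] and [p.1]. By
    boundedness of [phi] this changes the sum little, and the modified sum vanishes by
    [ideal_trace_sandwich]. *)
Lemma ideal_trace0 phi s : sigma_unital A -> tracial_states e phi ->
  ideal_elt s = 0 -> ideal_trace phi s = 0.
Proof.
move=> [u [_ ua _]] phiT s0; apply/normr0_eq0.
suff le0 : complex.Re `|ideal_trace phi s| <= 0.
  rewrite re_normE; suff -> : complex.Re `|ideal_trace phi s| = 0 by [].
  by apply/le_anti; rewrite le0 re_norm_ge0.
apply/ler_addgt0Pr => r r0; rewrite add0r.
(* There are two errors, each multiplied by the constant 4 of [state_nrm]. *)
have r8 : 0 < r / 8 by rewrite divr_gt0.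
have [N HN] := approx_unit_pairs s ua r8.
pose K := \sum_(p <- s) nrm p.2 * nrm p.1.
have K0 : 0 <= K by apply: sumr_ge0 => p _; rewrite mulr_ge0 ?nrm_ge0.
have K1 : 0 < K + 1 by lra.
have [t ut] := ideal_approx (u N) (divr_gt0 r8 K1).
rewrite ltr_pdivlMr// in ut.
rewrite -[ideal_trace _ _]subr0 -(ideal_trace_sandwich t phiT s0) -sumrB.
rewrite (le_trans (re_norm_sum _ _))//.
have : \sum_(p <- s) complex.Re `|phi (p.2 ** p.1) - phi (p.2 ** ideal_elt t ** p.1)|
   <= \sum_(p <- s) (4 * (nrm p.2 * nrm (p.1 - u N ** p.1)) +
                     4 * (nrm (u N - ideal_elt t) * (nrm p.2 * nrm p.1))).
  apply: ler_sum => p _.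
  have -> : phi (p.2 ** p.1) - phi (p.2 ** ideal_elt t ** p.1) =
     phi (p.2 ** (p.1 - u N ** p.1) + p.2 ** ((u N - ideal_elt t) ** p.1)).
    rewrite cmulBr cmulBl cmulBr addrA subrK !cmulA.
    by rewrite (stateB phiT).
  rewrite (le_trans (state_nrm e_proj phiT _))// -mulrDr ler_wpM2l//.
  rewrite (le_trans (nrmD _ _))// lerD ?nrmM// (le_trans (nrmM _ _))//.
  by rewrite mulrCA ler_wpM2l ?nrm_ge0// nrmM.
rewrite big_split /= -!mulr_sumr -/K => H.
have H1 := HN N (leqnn N); have := nrm_ge0 (u N - ideal_elt t).
by rewrite (le_trans H)//; nra.
Qed.

Context (A_sigma_unital : sigma_unital A).

Lemma ideal_trace_eq phi s t : tracial_states e phi ->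
  ideal_elt s = ideal_elt t -> ideal_trace phi s = ideal_trace phi t.
Proof.
move=> phiT st; apply/eqP; rewrite -subr_eq0 -mulN1r.
rewrite -(ideal_trace_scale _ _ phiT) -ideal_trace_cat; apply/eqP.
apply: ideal_trace0 => //.
by rewrite ideal_elt_cat ideal_elt_scale scaleN1r st subrr.
Qed.

Lemma ideal_trace_mvn phi p q s t : tracial_states e phi -> projections p ->
  mvn_equiv p q -> ideal_elt s = p -> ideal_elt t = q ->
  ideal_trace phi s = ideal_trace phi t.
Proof.
move=> phiT [ps pp] [v [vp vq]] sp tq.
(* The C*-identity applied to [v - v ** p]. *)
have vpv : v ** p = v.
  apply/eqP; rewrite eq_sym -subr_eq0; apply/eqP/normr0_eq0/eqP.
  rewrite -sqrf_eq0 -cnorm_star starB starM ps cmulBr !cmulBl !cmulA.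
  by rewrite -(cmulA p) vp !pp !subrr normr0.
transitivity (ideal_trace phi [seq (p ** x.1, x.2) | x <- s]).
  by apply: ideal_trace_eq => //; rewrite ideal_elt_mull sp pp.
transitivity (ideal_trace phi [seq (v ** x.1, x.2 ** star v) | x <- s]).
  rewrite /ideal_trace !big_map; apply: eq_bigr => x _ /=.
  by rewrite -vp !cmulA.
by apply: ideal_trace_eq => //; rewrite ideal_elt_mul sp vpv vq.
Qed.

Lemma state_ideal_trace phi a s : tracial_states e phi ->
  ideal_elt s = e ** a ** e -> phi a = ideal_trace phi s.
Proof.
move=> phiT sa.
rewrite -(ideal_trace_eq (s := [:: (e ** a, e)]) phiT); last first.
  by rewrite sa /ideal_elt big_seq1 /= -!cmulA e_proj.2.
rewrite /ideal_trace big_seq1 /= -[RHS](stateE phiT) !cmulA !e_proj.2.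
by rewrite (stateE phiT).
Qed.

End Ideal.

(** * The Baire argument *)

Section Baire.
Context {R : realType} {A : cstarAlgType R}.

(** Baire's argument with explicit nested balls: the [n]-th step moves into a smaller closed ball on
    which [L n] has no zero, and the centres converge to a point of all the balls. *)
Lemma avoid_kernels (L : nat -> A -> R[i]) (K : nat -> R) :
  (forall n x y, L n (x - y) = L n x - L n y) ->
  (forall n (c : R[i]) x, L n (c *: x) = c * L n x) ->
  (forall n x, complex.Re `|L n x| <= K n * nrm x) ->
  (forall n, exists w, L n w != 0) ->
  exists a, forall n, L n a != 0.
Proof.
move=> LB LZ LK Lw.
pose re (z : R[i]) := complex.Re `|z|.
have LD n x y : L n (x + y) = L n x + L n y.
  by apply: (@addIr _ (- L n y)); rewrite -LB !addrK.
have step (s : nat * (A * R)) : exists t : A * R, 0 < s.2.2 ->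
    [/\ 0 < t.2, t.2 <= rate s.1, nrm (t.1 - s.2.1) + t.2 <= s.2.2 &
     forall x, nrm (x - t.1) <= t.2 -> L s.1 x != 0].
  case: s => n [a r] /=; have [r0|r0] := ltP 0 r; last by exists (a, r).
  have [b [bL ab]] : exists b, L n b != 0 /\ nrm (b - a) <= r / 2.
    have [La|La] := eqVneq (L n a) 0; last by exists a; rewrite subrr nrm0 ltW// divr_gt0.
    have [w Lnw] := Lw n; have w0 := nrm_ge0 w.
    have k0 : 0 < 2 * (nrm w + 1) by lra.
    exists (a + (r / (2 * (nrm w + 1)))%:C *: w); split.
      rewrite LD La add0r LZ mulf_eq0 negb_or Lnw andbT.
      by rewrite -[0]/((0:R)%:C) (inj_eq (@complexI R)) gt_eqF// divr_gt0.
    rewrite addrC addKr nrmZr gtr0_norm ?divr_gt0// mulrAC ler_pdivrMr//.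
    by nra.
  have d0 : 0 < re (L n b) := re_norm_gt0 bL; have K0 : 0 < `|K n| + 1 by have := normr_ge0 (K n); lra.
  (* The three bounds keep the new ball inside the old one, make the centres Cauchy, and keep the
     variation of [L n] on the ball below its modulus at [b]. *)
  pose t := Num.min (Num.min (r / 2) (rate n)) (re (L n b) / (2 * (`|K n| + 1))).
  exists (b, t) => _; split => /=.
  - by rewrite !lt_min rate_gt0 !divr_gt0// mulr_gt0.
  - by rewrite /t !ge_min lexx orbT.
  - by have : t <= r / 2; [rewrite /t !ge_min lexx|lra].
  - move=> x xb; apply/eqP => Lx0.
    have tb : t * (2 * (`|K n| + 1)) <= re (L n b).
      by rewrite -ler_pdivlMr ?mulr_gt0// /t ge_min lexx orbT.
    have := LK n (x - b); rewrite LB Lx0 sub0r normrN -/(re _).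
    have := nrm_ge0 (x - b); have := ler_norm (K n).
    have := normr_ge0 (K n); nra.
have [F HF] := choice step.
pose st := fix st n := if n is m.+1 then F (m, st m) else (0, 1).
pose u n := (st n).1; pose rho n := (st n).2.
have pos n : 0 < rho n.
  by elim: n => //= n IH; have [] := HF (n, st n) IH.
have P n : [/\ rho n.+1 <= rate n, nrm (u n.+1 - u n) + rho n.+1 <= rho n &
    forall x, nrm (x - u n.+1) <= rho n.+1 -> L n x != 0].
  by have [] := HF (n, st n) (pos n).
have nest m k : nrm (u (m + k)%N - u m) + rho (m + k)%N <= rho m.
  elim: k => [|k IH]; first by rewrite addn0 subrr nrm0 add0r.
  rewrite addnS; have [_ H _] := P (m + k)%N.
  by have := nrm_dist (u (m + k)%N) (u (m + k).+1) (u m); lra.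
have [l Hl] : exists l, forall m, nrm (l - u m.+1) <= rate m * 1.
  apply: complete_rate => m n mn; rewrite mulr1.
  have := nest m.+1 (n - m)%N; rewrite addSn subnKC//.
  by have [? _ _] := P m; have := pos n.+1; lra.
exists l => n; have [_ _] := P n; apply.
apply: (@le_of_rate _ _ _ 1) => k.
pose j := maxn k n; have kj : (k <= j)%N by exact: leq_maxl.
have nj : (n <= j)%N by exact: leq_maxr.
have := nest n.+1 (j - n)%N; rewrite addSn subnKC// => H.
have H1 := Hl j; have H2 : rate j <= rate k :> R by exact: le_rate.
by have := nrm_dist (u j.+1) l (u n.+1); have := pos j.+1; lra.
Qed.

Lemma mvn_representatives : countable (mvn_classes A) ->
  exists (q : nat -> A) (k : A -> nat), forall p, projections p ->
    projections (q (k p)) /\ mvn_equiv (q (k p)) p.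
Proof.
move=> /countable_injP[g ginj].
pose S n := [set p : A | projections p /\ g (mvn_class p) = n].
(* A number that codes no class gets the default 0. *)
exists (fun n => xget 0 (S n)), (fun p => g (mvn_class p)) => p pP.
have [qP gq] : S (g (mvn_class p)) (xget 0 (S (g (mvn_class p)))).
  by apply: (@xgetPex _ 0 (S _)); exists p.
split=> //; set q := xget _ _ in qP gq *.
have qp : mvn_class q = mvn_class p.
  by apply: ginj; rewrite ?inE//=; [exists q|exists p].
have : mvn_class q p by rewrite qp; split => //; exists p; rewrite pP.1 pP.2.
by case.
Qed.

Lemma row_kernel (F : fieldType) n (M : 'I_n.+1 -> 'I_n -> F) :
  exists lam : 'I_n.+1 -> F, (exists i, lam i != 0) /\
    forall j, \sum_i lam i * M i j = 0.
Proof.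
pose N := \matrix_(i, j) M i j.
have : kermx N != 0.
  rewrite -mxrank_eq0 mxrank_ker subn_eq0 -ltnNge ltnS.
  exact: rank_leq_col.
move=> /rowV0Pn[v /sub_kermxP vN v0].
exists (v ord0); split; first by have /rV0Pn := v0.
move=> j; have := congr1 (fun B : 'rV_n => B ord0 j) vN; rewrite !mxE => H; rewrite -[RHS]H.
by apply: eq_bigr => i _; rewrite ?mxE.
Qed.

Context (e : A) (e_proj : projections e).

Lemma extreme_states_independent n (phi : 'I_n -> functionals A)
    (lam : 'I_n -> R[i]) :
  (forall i, extreme_points (tracial_states e) (phi i)) -> injective phi ->
  (forall b, \sum_i lam i * phi i b = 0) -> forall i, lam i = 0.
Proof.
move=> ext inj lam0.
have phiT i : tracial_states e (phi i) by case: (ext i).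
have finj : injective (fun i => re_state (phi i)).
  move=> i j ij; apply: inj; apply: funext => a.
  have E b : re_state (phi i) b = re_state (phi j) b by rewrite ij.
  apply/eqP; rewrite eq_complex (im_state (phiT i)) (im_state (phiT j)) !E eqxx andbT.
  by apply/eqP; exact: E.
(* Traces are real on self-adjoint elements, so the real and imaginary parts of
   the coefficients can be treated separately. *)
have real_vals i b : phi i (b + star b) = (2 * re_state (phi i) b)%:C.
  rewrite (stateD (phiT i)) (state_star e_proj (phiT i)) /re_state.
  by rewrite [LHS]addcJ rmorphM rmorph_nat.
have comb (g : R[i] -> R) : (forall z (r : R), g (z * r%:C) = g z * r) ->
    (forall z w, g (z + w) = g z + g w) -> g 0 = 0 -> forall i, g (lam i) = 0.
  move=> gZ gD g0; apply: (extreme_independent e_proj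
    (f := fun i => re_state (phi i))) => //.
  - by move=> i; exact: re_state_rtrace.
  - by move=> i; exact: re_state_extreme.
  - by move=> i; exact: re_state1.
  move=> b; have := congr1 g (lam0 (b + star b)).
  rewrite g0 (big_morph g gD g0) => H.
  have : 2 * \sum_i g (lam i) * re_state (phi i) b = 0.
    rewrite mulr_sumr -[RHS]H; apply: eq_bigr => i _.
    by rewrite real_vals gZ mulrCA.
  by move=> /eqP; rewrite mulf_eq0 pnatr_eq0 => /eqP.
move=> i; apply/eqP; rewrite eq_complex; apply/andP; split; apply/eqP.
  by apply: (comb (@complex.Re R)) => //; [case=> a b r /=; ring|case=> ? ? []].
by apply: (comb (@complex.Im R)) => //; [case=> a b r /=; ring|case=> ? ? []].
Qed.

End Baire.

(** * The span of the projections when there are countably many classes *)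

Theorem proposition5p1 (R : realType) (A : cstarAlgType R)
    (H : completeNormedModType R[i]) (ip : {dot H for Num.conj})
    (xi : nat -> H) (AK : cstarAlgType R) (t : A -> (H -> H) -> AK) (e : A)
    (ip_norm : hilbert_norm ip)
    (xi_basis : orthonormal_basis ip xi)
    (AK_tensor : is_tensor_compact ip t)
    (A_simple : is_simple A)
    (A_sigma_unital : sigma_unital A)
    (A_rr0 : real_rank_zero A)
    (e_base : base_projection e)
    (Ext_infinite : infinite_set (extreme_points (tracial_states e)))
    (D_countable : countable (mvn_classes A))
    (D_dense : dense_in_Aff_plus ip t xi e) :
  projection_span A <> setT.
Proof.
move=> spanA; have [e_proj e0 _] := e_base.
have dense := base_ideal_dense e_proj A_simple e0.
have [phi phiext phiinj] : exists2 phi : nat -> functionals A,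
    (forall n, extreme_points (tracial_states e) (phi n)) & injective phi.
  have /infiniteP/(@pcard_leP nat {ptws A -> R[i]^o})[f] := Ext_infinite.
  exists f; first by move=> n; exact: (@funS _ _ _ _ f n I).
  by move=> m n; apply: (@inj _ _ _ f); rewrite ?inE.
have phiT n : tracial_states e (phi n) by case: (phiext n).
have [q [k qP]] := mvn_representatives D_countable.
have /choice[S SP] p : exists s, projections p -> ideal_elt e s = p.
  have [pP|npP] := pselect (projections p); last by exists [::].
  by have [s _ sp] := projection_ideal dense pP; exists s.
pose tau i j := ideal_trace (phi i) (S (q j)).
(* There are [n] linear conditions on [n.+1] coefficients, so a nonzero solution exists. *)
have /choice[L LP] n : exists L : A -> R[i], exists lam : 'I_n.+1 -> R[i],
    [/\ (exists i, lam i != 0), forall a, L a = \sum_i lam i * phi i a &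
        forall j : 'I_n, \sum_i lam i * tau i j = 0].
  have [lam [lam0 lamtau]] := row_kernel (fun (i : 'I_n.+1) (j : 'I_n) => tau i j).
  by exists (fun a => \sum_i lam i * phi i a), lam.
have /choice[K KP] n : exists K, forall x, complex.Re `|L n x| <= K * nrm x.
  have [lam [_ Ln _]] := LP n; exists (\sum_i complex.Re `|lam i| * 4) => x.
  rewrite Ln (le_trans (re_norm_sum _ _))// mulr_suml ler_sum// => i _.
  by rewrite re_normM -mulrA ler_wpM2l ?re_norm_ge0// (state_nrm e_proj).
have [||//||a La] := @avoid_kernels _ _ L K.
- move=> n x y; have [lam [_ Ln _]] := LP n; rewrite !Ln -sumrB.
  by apply: eq_bigr => i _; rewrite (stateB (phiT i)) mulrBr.
- move=> n c x; have [lam [_ Ln _]] := LP n; rewrite !Ln mulr_sumr.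
  by apply: eq_bigr => i _; rewrite (stateZ (phiT i)) mulrCA.
- move=> n; have [lam [[i lami] Ln _]] := LP n.
  apply: contrapT => L0; move: lami.
  rewrite (extreme_states_independent e_proj (phi := fun i : 'I_n.+1 => phi i)
    (lam := lam)) ?eqxx//.
    by move=> j l /phiinj/ord_inj.
  move=> b; rewrite -Ln; apply/eqP; apply: contraT => Lb.
  by exfalso; apply: L0; exists b.
(* The traces see [a] only through this compression, whose expansion into projections yields a
   second presentation of it in AeA. *)
have [m [c [p [pP eae]]]] : projection_span A (e ** a ** e) by rewrite spanA.
pose s := \big[cat/[::]]_(l < m) [seq (c l *: x.1, x.2) | x <- S (p l)].
have es : ideal_elt e s = e ** a ** e.
  rewrite eae /s (big_morph (ideal_elt e) (@ideal_elt_cat _ _ e) (big_nil _ _ _ _)).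
  by apply: eq_bigr => l _; rewrite ideal_elt_scale SP.
(* The coefficients and the classes involved are the same for all [i]. *)
have phia i : phi i a = \sum_(l < m) c l * tau i (k (p l)).
  rewrite (state_ideal_trace e_proj dense A_sigma_unital (phiT i) es) /s.
  rewrite (big_morph (ideal_trace (phi i)) (@ideal_trace_cat _ _ (phi i)) (big_nil _ _ _ _)).
  apply: eq_bigr => l _; rewrite (ideal_trace_scale _ _ (phiT i)); congr (_ * _).
  have [qp1 qp2] := qP _ (pP l).
  by apply/esym/(ideal_trace_mvn e_proj dense A_sigma_unital (phiT i) qp1 qp2);
    apply: SP.
(* The successor makes every index [k (p l)] strictly smaller than [n], so [L n] annihilates all
   classes in the expansion and vanishes at [a]. *)
pose n := \max_(l < m) (k (p l)).+1.
have kn l : (k (p l) < n)%N by exact: (leq_bigmax (F := fun l => (k (p l)).+1)).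
have := La n; have [lam [_ Ln lam0]] := LP n.
rewrite Ln; under eq_bigr do rewrite phia mulr_sumr.
rewrite exchange_big big1 ?eqxx//= => l _.
under eq_bigr do rewrite mulrCA.
by rewrite -mulr_sumr (lam0 (Ordinal (kn l))) mulr0.
Qed.
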